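(* Let $P(\alpha,\beta)=\sum_{i=0}^k \alpha^i\beta^{k-i}B_i$, $B_i\in\mathbb{C}^{n\times n}$, be a regular homogeneous matrix polynomial of grade $k$, and let $(\alpha_0,\beta_0)\neq(0,0)$ be a simple eigenvalue of $P(\alpha,\beta)$. Let $\omega_0,\dots,\omega_k\ge0$ be weights, the same for both condition numbers below, with $\sum_{i=0}^k |\alpha_0|^{i}|\beta_0|^{k-i}\omega_i\neq 0$. Then the Dedieu–Tisseur condition number $\kappa_h$ and the Stewart–Sun condition number $\kappa_\theta$ satisfy $$\frac{1}{\sqrt{k+1}}\le\frac{\kappa_h((\alpha_0,\beta_0),P)}{\kappa_\theta((\alpha_0,\beta_0),P)}\le 1.$$
   Context: $P(\alpha,\beta)$ is regular if $\det P(\alpha,\beta)\not\equiv 0$. An eigenvalue of $P(\alpha,\beta)$ is a line through the origin in $\mathbb{C}^2$ consisting of solutions of $\det P(\alpha,\beta)=0$; it is denoted $(\alpha_0,\beta_0)$, where $(\alpha_0,\beta_0)\neq(0,0)$ also denotes a chosen representative. It is simple if $\det P(\alpha,\beta)$ has this line as a zero of multiplicity one. Nonzero $x,y\in\mathbb{C}^n$ are right and left eigenvectors associated with $(\alpha_0,\beta_0)$ if $P(\alpha_0,\beta_0)x=0$ and $y^*P(\alpha_0,\beta_0)=0$. $\|\cdot\|_2$ is the Euclidean norm on vectors and the spectral norm on matrices, and $D_a\equiv\partial/\partial a$. Dedieu–Tisseur condition number: given (independently of the representative) by $$\kappa_h((\alpha_0,\beta_0),P)=\left(\sum_{i=0}^k|\alpha_0|^{2i}|\beta_0|^{2(k-i)}\omega_i^2\right)^{1/2}\frac{\|y\|_2\|x\|_2}{|y^*(\overline{\beta_0}D_\alpha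 P(\alpha_0,\beta_0)-\overline{\alpha_0}D_\beta P(\alpha_0,\beta_0))x|},$$ where $x,y$ are right and left eigenvectors associated with $(\alpha_0,\beta_0)$. Chordal distance: for lines $\langle x\rangle,\langle y\rangle$ through the origin in $\mathbb{C}^2$ spanned by nonzero vectors $x,y$, $\theta(\langle x\rangle,\langle y\rangle)=\arccos\frac{|y^*x|}{\|x\|_2\|y\|_2}\in[0,\pi/2]$ and $\chi(\langle x\rangle,\langle y\rangle)=\sin\theta(\langle x\rangle,\langle y\rangle)$. Stewart–Sun condition number: $$\kappa_\theta((\alpha_0,\beta_0),P)=\lim_{\epsilon\to0}\sup\Big\{\frac{\chi((\alpha_0,\beta_0),(\alpha_0+\Delta\alpha_0,\beta_0+\Delta\beta_0))}{\epsilon}: [P+\Delta P](\alpha_0+\Delta\alpha_0,\beta_0+\Delta\beta_0)(x+\Delta x)=0,\ \|\Delta B_i\|_2\le\epsilon\,\omega_i,\ i=0,\dots,k\Big\},$$ where $\Delta P(\alpha,\beta)=\sum_{i=0}^k\alpha^i\beta^{k-i}\Delta B_i$, $x$ is a right eigenvector of $P$ for $(\alpha_0,\beta_0)$, $x+\Delta x$ is an associated right eigenvector of $P+\Delta P$, and $(\alpha_0+\Delta\alpha_0,\beta_0+\Delta\beta_0)$ is the unique simple eigenvalue of $P+\Delta P$ that approaches $(\alpha_0,\beta_0)$ as $\Delta P\to0$. *)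

(* Defs.v *)
From HB Require Import structures.
From mathcomp Require Import all_boot all_order all_algebra.
From mathcomp Require Import complex.
From mathcomp Require Import boolp classical_sets functions reals topology.
From mathcomp Require Import normedtype realfun trigo.

Set Implicit Arguments.
Unset Strict Implicit.
Unset Printing Implicit Defensive.

Import Order.TTheory GRing.Theory Num.Theory.
Import numFieldNormedType.Exports.

Local Open Scope classical_set_scope.
Local Open Scope ring_scope.

Section Norms.
Variable R : realType.
Local Notation C := R[i].

(* The norm `|z| of z : R[i] is itself an element of R[i]; this is its value
   as an element of R. *)
Definition cabs (z : C) : R := complex.Re `|z|.

Definition adjmx m n (A : 'M[C]_(m, n)) : 'M[C]_(n, m) :=
  (map_mx Num.conj A)^T.

Definition norm2 n (v : 'cV[C]_n) : R :=
  Num.sqrt (\sum_(i < n) cabs (v i 0) ^+ 2).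

(* The operator norm induced by norm2. *)
Definition specnorm n (A : 'M[C]_n) : R :=
  sup [set norm2 (A *m v) | v in [set v : 'cV[C]_n | norm2 v <= 1]].

(* A line through the origin of C^2 is given by a representative
   l = (alpha, beta) != (0, 0). *)
Definition cvec2 (l : C * C) : 'cV[C]_2 :=
  \col_(i < 2) if i == 0 then l.1 else l.2.

Definition angle (l m : C * C) : R :=
  acos (cabs ((adjmx (cvec2 m) *m cvec2 l) 0 0)
        / (norm2 (cvec2 l) * norm2 (cvec2 m))).

Definition chordal (l m : C * C) : R := sin (angle l m).

End Norms.

Section MatrixPolynomials.
Variables (R : realType) (n k : nat).
Local Notation C := R[i].
(* Coefficients B_0, ..., B_k of a homogeneous matrix polynomial of grade k. *)
Implicit Types (B dB : 'I_k.+1 -> 'M[C]_n) (l : C * C).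

(* In {poly {poly C}}, the outer indeterminate 'X stands for alpha and the
   inner one 'Y = 'X%:P for beta; p.[a, b] is the value at alpha = a,
   beta = b. *)
Definition hmxpoly B : 'M[{poly {poly C}}]_n :=
  \sum_(i < k.+1) ('X^i * 'Y ^+ (k - i)) *: map_mx (fun c : C => c%:P%:P) (B i).

Definition evalmx (M : 'M[{poly {poly C}}]_n) l : 'M[C]_n :=
  map_mx (fun p : {poly {poly C}} => p.[l.1, l.2]) M.

Definition Dalpha (M : 'M[{poly {poly C}}]_n) : 'M[{poly {poly C}}]_n :=
  map_mx (fun p : {poly {poly C}} => p^`()) M.

Definition Dbeta (M : 'M[{poly {poly C}}]_n) : 'M[{poly {poly C}}]_n :=
  map_mx (fun p : {poly {poly C}} => map_poly (fun q : {poly C} => q^`()) p) M.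

Definition regular B : Prop := \det (hmxpoly B) != 0.

Definition is_eigenvalue B l : Prop :=
  l != (0, 0) /\ (\det (hmxpoly B)).[l.1, l.2] = 0.

(* The linear form vanishing exactly on the line spanned by l. *)
Definition line_form l : {poly {poly C}} :=
  l.2%:P%:P * 'X - l.1%:P%:P * 'Y.

Definition line_multiplicity (p : {poly {poly C}}) l (m : nat) : Prop :=
  (exists q, p = line_form l ^+ m * q) /\
  ~ (exists q, p = line_form l ^+ m.+1 * q).

Definition simple_eigenvalue B l : Prop :=
  is_eigenvalue B l /\ line_multiplicity (\det (hmxpoly B)) l 1.

Definition right_eigenvector B l (x : 'cV[C]_n) : Prop :=
  x != 0 /\ evalmx (hmxpoly B) l *m x = 0.

Definition left_eigenvector B l (y : 'cV[C]_n) : Prop :=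
  y != 0 /\ adjmx y *m evalmx (hmxpoly B) l = 0.

Definition kappa_h (w : 'I_k.+1 -> R) B l (x y : 'cV[C]_n) : R :=
  Num.sqrt (\sum_(i < k.+1)
    cabs l.1 ^+ (2 * i) * cabs l.2 ^+ (2 * (k - i)) * w i ^+ 2)
  * (norm2 y * norm2 x /
     cabs ((adjmx y *m (Num.conj l.2 *: evalmx (Dalpha (hmxpoly B)) l
                        - Num.conj l.1 *: evalmx (Dbeta (hmxpoly B)) l)
            *m x) 0 0)).

Definition addcoef B dB : 'I_k.+1 -> 'M[C]_n := fun i => B i + dB i.

(* lam dB is a simple eigenvalue of the polynomial perturbed by dB, for all
   small enough dB, and it tends to the line l as dB tends to 0. *)
Definition approaching_eigenvalue B l
    (lam : ('I_k.+1 -> 'M[C]_n) -> C * C) : Prop :=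
  forall e : R, 0 < e -> exists2 d : R, 0 < d &
    forall dB, (forall i, specnorm (dB i) <= d) ->
      simple_eigenvalue (addcoef B dB) (lam dB) /\ chordal l (lam dB) <= e.

(* When l is a simple eigenvalue, such a map exists and is unique, as a map to
   lines, on a neighbourhood of dB = 0; only that neighbourhood matters for
   kappa_theta. *)
Definition perturbed_eigenvalue B l : ('I_k.+1 -> 'M[C]_n) -> C * C :=
  xget (fun=> l) [set lam | approaching_eigenvalue B l lam].

(* Taken in R: chordal is at most 1 and dB = 0 is admissible for all small
   eps > 0. *)
Definition sup_ratio (w : 'I_k.+1 -> R) B l (eps : R) : R :=
  sup [set r : R | exists dB (x dx : 'cV[C]_n),
    [/\ right_eigenvector B l x,
        right_eigenvector (addcoef B dB) (perturbed_eigenvalue B l dB) (x + dx),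
        (forall i, specnorm (dB i) <= eps * w i)
      & r = chordal l (perturbed_eigenvalue B l dB) / eps]].

Definition kappa_theta (w : 'I_k.+1 -> R) B l : R :=
  lim (sup_ratio w B l eps @[eps --> 0^'+]).

End MatrixPolynomials.

(* Main.v *)
(* Move along the affine line t |-> l + t n through l, with normal direction
   n = (conj beta0, - conj alpha0). The chordal distance from l to the line
   spanned by l + t n is |t| / sqrt (1 + |t|^2), so only the root t near 0 of
   det ((P + dP)(l + t n)) matters. At the simple eigenvalue the adjugate of
   P(l) is c x y^* with c != 0, and multiplying (P + dP)(l + t n) by its adjugate
   gives, to first order, t (y^* D x) + y^* dP(l) x = 0, where
   D = conj beta0 D_alpha P - conj alpha0 D_beta P. Maximizing |y^* dP(l) x| over
   the admissible perturbations yields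
     kappa_theta = (sum_i c_i) |x| |y| / |y^* D x|,
     c_i = |alpha0|^i |beta0|^(k-i) w_i,
   while kappa_h has (sum_i c_i^2)^(1/2) in place of sum_i c_i. *)

Require Import Defs.
From mathcomp Require Import all_boot all_order all_fingroup all_algebra.
From mathcomp Require Import ring lra zify.
From mathcomp Require Import complex.
From mathcomp Require Import boolp classical_sets reals topology.
From mathcomp Require Import normedtype trigo.

Set Implicit Arguments.
Unset Strict Implicit.
Unset Printing Implicit Defensive.

Import Order.TTheory GRing.Theory Num.Theory.
Import numFieldNormedType.Exports.

Local Open Scope classical_set_scope.
Local Open Scope ring_scope.

(** Two obstacles shape the argument. [perturbed_eigenvalue] is an arbitrary choice among the maps
    satisfying [approaching_eigenvalue]: one such map has to be constructed, and the estimates may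
    then use only that its values are simple eigenvalues close to [l]. And the supremum ranges over
    all [dB] of size [eps], so every error constant must be independent of [dB]. Explicit bounds
    therefore replace the implicit function theorem: the determinant along the normal line is a
    polynomial in t of degree at most nk, Lipschitz in small [dB], and an estimate on p'/p makes its
    simple root persist. The first-order equation has an error of order (|t| + eps)^2 in which t is
    at first only known to be small; absorbing part of it into the linear term yields |t| = O(eps),
    hence an error O(eps^2). The adjugate keeps perturbed eigenvectors out of the estimates: it is
    polynomial in the entries, hence locally Lipschitz, and needs no normalization. *)

(** * Complex moduli as real numbers *)

Section Moduli.
Variable R : realType.
Local Notation C := R[i].
Implicit Types z u : C.

Lemma cabsE z : (cabs z)%:C%C = `|z|.
Proof. by rewrite /cabs normc_def. Qed.

Lemma cabs_ge0 z : 0 <= cabs z.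
Proof. by rewrite -ler0c cabsE normr_ge0. Qed.

Lemma cabsM z u : cabs (z * u) = cabs z * cabs u.
Proof. by apply: complexI; rewrite rmorphM !cabsE normrM. Qed.

Lemma cabsD z u : cabs (z + u) <= cabs z + cabs u.
Proof. by rewrite -lecR rmorphD !cabsE ler_normD. Qed.

Lemma cabsN z : cabs (- z) = cabs z.
Proof. by rewrite /cabs normrN. Qed.

Lemma cabs0 : cabs 0 = 0 :> R.
Proof. by rewrite /cabs normr0. Qed.

Lemma cabs1 : cabs 1 = 1 :> R.
Proof. by rewrite /cabs normr1. Qed.

Lemma cabs_eq0 z : (cabs z == 0) = (z == 0).
Proof. by rewrite -(inj_eq (@complexI R)) cabsE rmorph0 normr_eq0. Qed.

Lemma cabs_gt0 z : (0 < cabs z) = (z != 0).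
Proof. by rewrite lt0r cabs_eq0 cabs_ge0 andbT. Qed.

Lemma cabsX z m : cabs (z ^+ m) = cabs z ^+ m.
Proof. by elim: m => [|m IH]; rewrite ?expr0 ?cabs1 // !exprS cabsM IH. Qed.

Lemma cabsC z : cabs (Num.conj z) = cabs z.
Proof. by rewrite /cabs norm_conjC. Qed.

Lemma cabsR (r : R) : 0 <= r -> cabs r%:C%C = r.
Proof. by move=> r0; rewrite /cabs ger0_norm // ler0c. Qed.

Lemma mul_conj z : z * Num.conj z = (cabs z ^+ 2)%:C%C.
Proof. by rewrite -normCK rmorphXn /= cabsE. Qed.

Lemma cabs_sum (I : Type) (r : seq I) (P : pred I) (F : I -> C) :
  cabs (\sum_(i <- r | P i) F i) <= \sum_(i <- r | P i) cabs (F i).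
Proof.
apply: (big_ind2 (fun z (s : R) => cabs z <= s)) => //; first by rewrite cabs0.
by move=> z s u t zs ut; apply: le_trans (cabsD _ _) (lerD zs ut).
Qed.

Lemma cabs_sub z u : cabs z <= cabs u + cabs (z - u).
Proof. by rewrite -{1}(subrK u z) addrC cabsD. Qed.

Lemma conj_invol z : Num.conj (Num.conj z) = z.
Proof. exact: conjCK. Qed.

End Moduli.

(** * Euclidean and spectral norms *)

Section Norms.
Variable R : realType.
Local Notation C := R[i].

Lemma sumr_sqr_ge0 n (f : 'I_n -> R) : 0 <= \sum_i f i ^+ 2.
Proof. by apply: sumr_ge0 => i _; apply: sqr_ge0. Qed.

(** Expanding the sum of the squares (G f_i - F g_i)^2 gives 2 F G (F G - sum f_i g_i); the cases F
    = 0 and G = 0 are treated apart because the factor F G is cancelled. *)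
Lemma cauchy_schwarz n (f g : 'I_n -> R) :
  \sum_i f i * g i <= Num.sqrt (\sum_i f i ^+ 2) * Num.sqrt (\sum_i g i ^+ 2).
Proof.
set F := Num.sqrt _; set G := Num.sqrt _.
have F2 : F ^+ 2 = \sum_i f i ^+ 2 by rewrite sqr_sqrtr ?sumr_sqr_ge0.
have G2 : G ^+ 2 = \sum_i g i ^+ 2 by rewrite sqr_sqrtr ?sumr_sqr_ge0.
have zero (h : 'I_n -> R) : Num.sqrt (\sum_i h i ^+ 2) = 0 -> forall i, h i = 0.
  move=> /eqP; rewrite sqrtr_eq0 => hle i; apply/eqP; rewrite -sqrf_eq0.
  have /eqP : \sum_i h i ^+ 2 = 0 by apply/eqP; rewrite eq_le hle sumr_sqr_ge0.
  rewrite psumr_eq0 => [/allP/(_ i)|j _]; last exact: sqr_ge0.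
  by rewrite mem_index_enum => /(_ isT).
have [F0|Fn0] := eqVneq F 0.
  rewrite F0 mul0r big1 // => i _; by rewrite (zero f F0) mul0r.
have [G0|Gn0] := eqVneq G 0.
  rewrite G0 mulr0 big1 // => i _; by rewrite (zero g G0) mulr0.
have Fp : 0 < F by rewrite lt0r Fn0 sqrtr_ge0.
have Gp : 0 < G by rewrite lt0r Gn0 sqrtr_ge0.
have : 0 <= \sum_i (G * f i - F * g i) ^+ 2 by apply: sumr_sqr_ge0.
have -> : \sum_i (G * f i - F * g i) ^+ 2
          = (F * G) *+ 2 * (F * G - \sum_i f i * g i).
  have -> : \sum_i (G * f i - F * g i) ^+ 2 =
    \sum_i (G ^+ 2 * f i ^+ 2 + F ^+ 2 * g i ^+ 2 - (F * G) *+ 2 * (f i * g i)).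
    by apply: eq_bigr => i _; ring.
  rewrite sumrB big_split /= -!mulr_sumr -F2 -G2; ring.
by rewrite pmulr_rge0 ?subr_ge0 // pmulrn_lgt0 // mulr_gt0.
Qed.

Lemma norm2_ge0 n (v : 'cV[C]_n) : 0 <= norm2 v.
Proof. exact: sqrtr_ge0. Qed.

Lemma norm2_sqr n (v : 'cV[C]_n) : norm2 v ^+ 2 = \sum_i cabs (v i 0) ^+ 2.
Proof. by rewrite sqr_sqrtr ?sumr_sqr_ge0. Qed.

Lemma norm2_eq0 n (v : 'cV[C]_n) : (norm2 v == 0) = (v == 0).
Proof.
rewrite -sqrf_eq0 norm2_sqr psumr_eq0 => [|i _]; last exact: sqr_ge0.
apply/allP/eqP => [v0|-> i _]; last by rewrite /= mxE cabs0 expr0n eqxx.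
apply/colP => i; have := v0 i; rewrite mem_index_enum sqrf_eq0 cabs_eq0 mxE.
by move/(_ isT)/eqP.
Qed.

Lemma norm2_gt0 n (v : 'cV[C]_n) : (0 < norm2 v) = (v != 0).
Proof. by rewrite lt0r norm2_eq0 norm2_ge0 andbT. Qed.

Lemma norm2Z n (c : C) (v : 'cV[C]_n) : norm2 (c *: v) = cabs c * norm2 v.
Proof.
rewrite /norm2 -[cabs c](ger0_norm (cabs_ge0 _)) -sqrtr_sqr -sqrtrM ?sqr_ge0 //.
rewrite mulr_sumr; congr Num.sqrt; apply: eq_bigr => i _.
by rewrite mxE cabsM exprMn.
Qed.

Lemma cabs_le_norm2 n (v : 'cV[C]_n) i : cabs (v i 0) <= norm2 v.
Proof.
rewrite -[cabs _](ger0_norm (cabs_ge0 _)) -sqrtr_sqr ler_sqrt ?sumr_sqr_ge0 //.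
by rewrite (bigD1 i) //= lerDl sumr_ge0 // => j _; apply: sqr_ge0.
Qed.

Lemma cabs_dot n (u v : 'cV[C]_n) :
  cabs ((adjmx u *m v) 0 0) <= norm2 u * norm2 v.
Proof.
rewrite mxE (le_trans (cabs_sum _ _ _)) //.
apply: le_trans (cauchy_schwarz (fun i => cabs (u i 0)) (fun i => cabs (v i 0))).
by apply: ler_sum => i _; rewrite cabsM !mxE cabsC.
Qed.

Lemma dot_self n (u : 'cV[C]_n) : (adjmx u *m u) 0 0 = (norm2 u ^+ 2)%:C%C.
Proof.
rewrite norm2_sqr rmorph_sum mxE; apply: eq_bigr => i _.
by rewrite !mxE mulrC mul_conj.
Qed.

Lemma norm2_le n (v : 'cV[C]_n) (e : R) :
  0 <= e -> (forall i, cabs (v i 0) <= e) -> norm2 v <= n%:R * e.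
Proof.
move=> e0 ve; rewrite -[n%:R * e]ger0_norm ?mulr_ge0 // -sqrtr_sqr.
rewrite ler_wsqrtr //.
apply: (@le_trans _ _ (\sum_(i < n) e ^+ 2)).
  by apply: ler_sum => i _; rewrite lerXn2r ?nnegrE ?cabs_ge0.
rewrite sumr_const card_ord exprMn -[leLHS]mulr_natl ler_wpM2r ?sqr_ge0 //.
by rewrite -natrX ler_nat; case: (n) => // m; rewrite expnS leq_pmulr.
Qed.

(** [sup] has its order properties only on a nonempty set bounded above, so this precedes any use of
    [specnorm]. The bound n times the sum of all the |A i j| is crude but enough. *)
Lemma specnorm_has_sup n (A : 'M[C]_n) :
  has_sup [set norm2 (A *m v) | v in [set v : 'cV[C]_n | norm2 v <= 1]].
Proof.
split; first by exists (norm2 (A *m 0)); exists 0 => //=;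
  rewrite (eqP (_ : norm2 0 == 0)) ?norm2_eq0.
pose a := \sum_i \sum_j cabs (A i j).
have a0 : 0 <= a by do 2![apply: sumr_ge0 => ? _]; apply: cabs_ge0.
exists (n%:R * a) => _ [v /= v1 <-].
apply: norm2_le => // i; rewrite mxE (le_trans (cabs_sum _ _ _)) //.
rewrite /a [leRHS](bigD1 i) //= -[leLHS]addr0 lerD //; last first.
  by do 2![apply: sumr_ge0 => ? _]; apply: cabs_ge0.
apply: ler_sum => j _; rewrite cabsM ler_piMr ?cabs_ge0 //.
exact: le_trans (cabs_le_norm2 _ _) v1.
Qed.

Lemma norm2_mulmx n (A : 'M[C]_n) (v : 'cV[C]_n) :
  norm2 (A *m v) <= specnorm A * norm2 v.
Proof.
have [->|vn0] := eqVneq v 0.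
  by rewrite mulmx0 (eqP (_ : norm2 0 == 0)) ?norm2_eq0 // mulr0.
have vp : 0 < norm2 v by rewrite norm2_gt0.
rewrite -ler_pdivrMr // mulrC.
have -> : (norm2 v)^-1 * norm2 (A *m v)
          = norm2 (A *m (((norm2 v)^-1)%:C%C *: v)).
  by rewrite -scalemxAr norm2Z cabsR ?invr_ge0 ?norm2_ge0.
apply: ub_le_sup; first by case: (specnorm_has_sup A).
by eexists; last reflexivity; rewrite /= norm2Z cabsR ?invr_ge0 ?norm2_ge0 // mulVf ?gt_eqF.
Qed.

Lemma specnorm_ge0 n (A : 'M[C]_n) : 0 <= specnorm A.
Proof.
apply: (@le_trans _ _ (norm2 (A *m 0))); first exact: norm2_ge0.
apply: ub_le_sup; first by case: (specnorm_has_sup A).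
by exists 0 => //=; rewrite (eqP (_ : norm2 0 == 0)) ?norm2_eq0.
Qed.

(** Column j is the image of a unit vector. Spectral bounds on a perturbation thus become entrywise
    ones, in which the error estimates are carried out. *)
Lemma cabs_le_specnorm n (A : 'M[C]_n) i j : cabs (A i j) <= specnorm A.
Proof.
have nd : norm2 (delta_mx j 0 : 'cV[C]_n) = 1.
  rewrite -[LHS]ger0_norm ?norm2_ge0 // -sqrtr_sqr norm2_sqr (bigD1 j) //=.
  rewrite big1 ?mxE ?eqxx ?cabs1 ?expr1n ?addr0 ?sqrtr1 // => k /negPf kj.
  by rewrite mxE kj cabs0 expr0n.
have := norm2_mulmx A (delta_mx j 0); rewrite nd mulr1; apply: le_trans.
apply: le_trans (cabs_le_norm2 _ i); rewrite -colE mxE; exact: lexx.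
Qed.

Lemma cabs_bilin n (A : 'M[C]_n) (x y : 'cV[C]_n) :
  cabs ((adjmx y *m A *m x) 0 0) <= norm2 y * norm2 x * specnorm A.
Proof.
rewrite -mulmxA (le_trans (cabs_dot _ _)) // -mulrA ler_wpM2l ?norm2_ge0 //.
by rewrite mulrC norm2_mulmx.
Qed.

Lemma specnorm_rank1 n (c : C) (x y : 'cV[C]_n) :
  specnorm (c *: (y *m adjmx x)) <= cabs c * (norm2 y * norm2 x).
Proof.
apply: ge_sup; first by case: (specnorm_has_sup (c *: (y *m adjmx x))).
move=> _ [v /= v1 <-].
rewrite -scalemxAl norm2Z ler_wpM2l ?cabs_ge0 //.
rewrite -mulmxA [adjmx x *m v]mx11_scalar mul_mx_scalar norm2Z mulrC.
rewrite ler_wpM2l ?norm2_ge0 // (le_trans (cabs_dot _ _)) //.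
by rewrite ler_piMr ?norm2_ge0.
Qed.

End Norms.

(** * Restriction of bivariate polynomials to an affine line *)

Section Along.
Variables (K : comNzRingType) (l d : K * K).

(** The polynomial p(l + t d) in t. Both substitutions are ring morphisms, so the operation commutes
    with determinants. *)
Definition along : {poly {poly K}} -> {poly K} :=
  horner_eval (l.1%:P + d.1 *: 'X) \o map_poly (comp_poly (l.2%:P + d.2 *: 'X)).

Lemma along0 : along 0 = 0.
Proof. by rewrite /along /= map_poly0 /horner_eval horner0. Qed.

Lemma alongB p q : along (p - q) = along p - along q.
Proof. by rewrite /along /= !rmorphB. Qed.

Lemma alongM p q : along (p * q) = along p * along q.
Proof. by rewrite /along /= !rmorphM. Qed.

Lemma along_exp p m : along (p ^+ m) = along p ^+ m.
Proof. by rewrite /along /= !rmorphXn. Qed.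

Lemma along_sum (I : Type) (r : seq I) (P : pred I) (F : I -> {poly {poly K}}) :
  along (\sum_(i <- r | P i) F i) = \sum_(i <- r | P i) along (F i).
Proof. by rewrite /along /= !rmorph_sum. Qed.

Lemma det_along n (A : 'M[{poly {poly K}}]_n) :
  \det (map_mx along A) = along (\det A).
Proof. by rewrite /along map_mx_comp !det_map_mx. Qed.

Lemma alongMXaddC p c :
  along (p * 'X + c%:P)
  = along p * (l.1%:P + d.1 *: 'X) + (c \Po (l.2%:P + d.2 *: 'X)).
Proof.
by rewrite /along /= rmorphD rmorphM /= map_polyX map_polyC /horner_eval !hornerE.
Qed.

Lemma alongX : along 'X = l.1%:P + d.1 *: 'X.
Proof. by rewrite /along /= map_polyX /horner_eval hornerX. Qed.

Lemma alongY : along 'Y = l.2%:P + d.2 *: 'X.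
Proof. by rewrite /along /= map_polyC /horner_eval hornerC /= comp_polyX. Qed.

Lemma alongC c : along c%:P%:P = c%:P.
Proof. by rewrite /along /= map_polyC /horner_eval hornerC /= comp_polyC. Qed.

Lemma horner_along p t : (along p).[t] = p.[l.1 + d.1 * t, l.2 + d.2 * t].
Proof.
elim/poly_ind: p => [|p c IH]; first by rewrite along0 !horner0.
by rewrite alongMXaddC !hornerE IH horner_comp !hornerE.
Qed.

Lemma horner_along0 p : (along p).[0] = p.[l.1, l.2].
Proof. by rewrite horner_along !mulr0 !addr0. Qed.

(** The chain rule, by Horner induction. For the normal direction it turns the combination of
    partial derivatives in [kappa_h] into an ordinary derivative in t. *)
Lemma deriv_along0 p :
  (along p)^`().[0]
  = d.1 * p^`().[l.1, l.2] + d.2 * (map_poly (fun q : {poly K} => q^`()) p).[l.1, l.2].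
Proof.
elim/poly_ind: p => [|p c IH].
  by rewrite along0 !deriv0 map_poly0 !horner0 !mulr0 addr0.
have -> : map_poly (fun q : {poly K} => q^`()) (p * 'X + c%:P)
    = map_poly (fun q : {poly K} => q^`()) p * 'X + (c^`())%:P.
  apply/polyP => i; rewrite coef_map_id0 ?deriv0 //.
  rewrite !coefD !coefMX !coefC; case: i => [|i] /=; first by rewrite !add0r.
  by rewrite !addr0 coef_map_id0 ?deriv0.
rewrite alongMXaddC !derivE deriv_comp !hornerE IH horner_comp.
rewrite !derivE !hornerE /= horner_along0; ring.
Qed.

End Along.

(** * Homogeneous bivariate polynomials and their linear factors *)

Section Homogeneous.
Variable K : fieldType.
Implicit Types (p q : {poly {poly K}}) (l : K * K).

Definition homog N p := forall i j, (i + j)%N != N -> p`_i`_j = 0.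

Lemma homog0 N : homog N 0.
Proof. by move=> i j _; rewrite !coef0. Qed.

Lemma homogD N p q : homog N p -> homog N q -> homog N (p + q).
Proof. by move=> hp hq i j ij; rewrite !coefD hp // hq // addr0. Qed.

Lemma homogN N p : homog N p -> homog N (- p).
Proof. by move=> hp i j ij; rewrite !coefN hp // oppr0. Qed.

Lemma homogC c : homog 0%N c%:P%:P.
Proof. by move=> [|i] [|j] //= _; rewrite !coefC //= ?coef0 // coefC. Qed.

Lemma homogM N M p q : homog N p -> homog M q -> homog (N + M)%N (p * q).
Proof.
move=> hp hq i j ij; rewrite coefM coef_sum big1 // => u _.
rewrite coefM big1 // => v _.
have [uv|uv] := eqVneq (u + v)%N N; last by rewrite hp // mul0r.
rewrite hq ?mulr0 //; apply: contraNneq ij => e.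
have ui : (u <= i)%N by rewrite -ltnS.
have vj : (v <= j)%N by rewrite -ltnS.
by apply/eqP; lia.
Qed.

Lemma homogX : homog 1%N ('X : {poly {poly K}}).
Proof. by move=> [|[|i]] [|j] //= _; rewrite coefX /= ?coef0 // coefC. Qed.

Lemma homogY : homog 1%N 'Y.
Proof. by move=> [|i] [|[|j]] //= _; rewrite coefC /= ?coefX ?coef0. Qed.

Lemma homogXn N p m : homog N p -> homog (m * N)%N (p ^+ m).
Proof.
move=> hp; elim: m => [|m IH]; first by rewrite expr0; apply: homogC.
by rewrite exprS mulSn; apply: homogM.
Qed.

Lemma homog_sum (I : Type) (r : seq I) (P : pred I) N (F : I -> {poly {poly K}}) :
  (forall i, P i -> homog N (F i)) -> homog N (\sum_(i <- r | P i) F i).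
Proof.
move=> h; apply: (big_ind (homog N)) => //; first exact: homog0.
exact: homogD.
Qed.

Lemma homog_det n N (A : 'M[{poly {poly K}}]_n) :
  (forall i j, homog N (A i j)) -> homog (n * N)%N (\det A).
Proof.
move=> hA; apply: homog_sum => s _.
have -> : (n * N = 0 + \sum_(i < n) N)%N by rewrite sum_nat_const card_ord.
apply: homogM; first by case: (s : bool); rewrite ?expr1 ?expr0; [apply: homogN|]; apply: homogC.
apply: (big_ind2 (fun m p => homog m p)) => //; first exact: homogC.
by move=> *; apply: homogM.
Qed.

(** Homogenization beta^N f(alpha/beta) for f of degree at most N; [dehom] goes back by setting beta
    = 1 in a homogeneous polynomial, so that univariate root theory applies. *)
Definition hpoly N (f : {poly K}) : {poly {poly K}} :=
  \poly_(i < N.+1) (f`_i *: 'X^(N - i)).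

Definition dehom N p : {poly K} := \poly_(i < N.+1) p`_i`_(N - i).

Lemma coef_hpoly N f i j :
  (hpoly N f)`_i`_j = if (i + j == N)%N then f`_i else 0.
Proof.
rewrite coef_poly ltnS; case: leqP => iN; last first.
  by rewrite coef0; case: eqP => // e; move: iN; rewrite -e ltnNge leq_addr.
rewrite coefZ coefXn; have -> : (j == N - i)%N = (i + j == N)%N by lia.
by case: eqP; rewrite ?mulr1 ?mulr0.
Qed.

Lemma homog_hpoly N f : homog N (hpoly N f).
Proof. by move=> i j /negPf ij; rewrite coef_hpoly ij. Qed.

Lemma dehomK N p : homog N p -> hpoly N (dehom N p) = p.
Proof.
move=> hp; apply/polyP => i; apply/polyP => j; rewrite coef_hpoly.
case: (eqVneq (i + j)%N N) => [<-|/hp //].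
by rewrite coef_poly ltnS leq_addr addKn.
Qed.

Lemma horner_hpoly N f a b :
  (hpoly N f).[a, b] = \sum_(i < N.+1) f`_i * b ^+ (N - i) * a ^+ i.
Proof.
rewrite horner_poly horner_sum; apply: eq_bigr => i _.
by rewrite -rmorphXn hornerM hornerC hornerZ hornerXn.
Qed.

Lemma homog_horner N p a b c : homog N p ->
  p.[c * a, c * b] = c ^+ N * p.[a, b].
Proof.
move=> /dehomK <-; rewrite !horner_hpoly mulr_sumr; apply: eq_bigr => i _.
have iN : (i <= N)%N by rewrite -ltnS.
have -> : c ^+ N = c ^+ (N - i) * c ^+ i by rewrite -exprD subnK.
by rewrite !exprMn; ring.
Qed.

(** A homogeneous factor theorem: comparing coefficients of total degree N reduces it to a
    recurrence for one univariate [g]. The cofactor is kept homogeneous so that the same form can be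
    divided out a second time. *)
Lemma homog_factor N p (a b : K) : (a, b) != (0, 0) -> homog N p -> p.[a, b] = 0 ->
  exists2 q, homog N.-1 q & p = (b%:P%:P * 'X - a%:P%:P * 'Y) * q.
Proof.
move=> ab0 hp pl; case: N hp => [|N] hp.
  exists 0; first exact: homog0.
  move: pl; rewrite mulr0 -(dehomK hp) horner_hpoly big_ord1 !expr0 !mulr1 => f0.
  apply/polyP => i; apply/polyP => j; rewrite coef_hpoly !coef0.
  by case: eqP => // /eqP; rewrite addn_eq0 => /andP[/eqP -> _].
have Lhom : homog 1%N (b%:P%:P * 'X - a%:P%:P * 'Y).
  apply: homogD; last apply: homogN.
    by rewrite -[1%N]add0n; apply: homogM; [apply: homogC|apply: homogX].
  by rewrite -[1%N]add0n; apply: homogM; [apply: homogC|apply: homogY].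
suff [g [gN gE]] : exists g : {poly K}, g`_N.+1 = 0 /\
    forall i, (i <= N.+1)%N ->
      p`_i`_(N.+1 - i) = (if i is i'.+1 then b * g`_i' else 0) - a * g`_i.
  exists (hpoly N g); first exact: homog_hpoly.
  apply/polyP => i; apply/polyP => j.
  have [ij|ij] := eqVneq (i + j)%N N.+1; last first.
    by rewrite hp // (homogM Lhom (homog_hpoly (N := N) g)).
  have jE : j = (N.+1 - i)%N by lia.
  have iN : (i <= N.+1)%N by lia.
  rewrite jE gE // -jE mulrBl -!mulrA !coefB !coefCM [in LHS]mulrC mulrC.
  congr (_ - _).
    rewrite coefXM; case: (i) ij => [|i'] ij /=; first by rewrite coef0 mulr0.
    by rewrite coef_hpoly (_ : (i' + j == N)%N) //; lia.
  rewrite coefXM; case: (j) ij => [|j'] ij /=.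
    have -> : i = N.+1 by lia.
    by rewrite gN mulr0.
  by rewrite coef_hpoly (_ : (i + j' == N)%N) //; lia.
(* For b = 0 the root lies at infinity: the form is -a beta, p has no pure power of alpha, and
   dividing by beta only shifts indices. Otherwise a / b is a root of the dehomogenization. *)
have [b0|bn0] := eqVneq b 0.
  have an0 : a != 0 by apply: contraNneq ab0 => ->; rewrite b0.
  pose f : {poly K} := \poly_(i < N.+1) p`_i`_(N.+1 - i).
  exists (- a^-1 *: f); split; first by rewrite coefZ coef_poly ltnn mulr0.
  have pN : p`_N.+1`_0 = 0.
    have := pl; rewrite -{1}(dehomK hp) horner_hpoly big_ord_recr /= b0 subnn expr0 mulr1.
    rewrite big1 => [|i _].
      move/eqP; rewrite add0r mulf_eq0 expf_eq0 (negPf an0) andbF orbF.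
      by rewrite coef_poly ltnS leqnn subnn => /eqP.
    by rewrite subSn -1?ltnS ?expr0n /= ?mulr0 ?mul0r.
  move=> i iN; rewrite b0 coefZ mulNr mulrN opprK mulVKf // coef_poly.
  have -> : (if i is i'.+1 then 0 * (- a^-1 *: f)`_i' else 0) = 0.
    by case: (i) => // ?; rewrite mul0r.
  rewrite add0r; case: ltnP => // Ni.
  have -> : i = N.+1 by lia.
  by rewrite subnn.
pose f := dehom N.+1 p.
have /factor_theorem [g fE] : root f (a / b).
  have : p.[b * (a / b), b * 1] = 0 by rewrite mulr1 mulrC divfK.
  rewrite (homog_horner _ _ _ hp) => /eqP; rewrite mulf_eq0 expf_eq0 (negPf bn0) andbF /=.
  rewrite -(dehomK hp) horner_hpoly rootE -/f (@horner_coef_wide _ N.+2); last exact: size_poly.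
  by under eq_bigr => i _ do rewrite expr1n mulr1.
exists (b^-1 *: g); split.
  have [->|gn0] := eqVneq g 0; first by rewrite scaler0 coef0.
  have := size_poly N.+2 (fun i => p`_i`_(N.+1 - i)).
  rewrite -/(dehom N.+1 p) -/f fE size_Mmonic ?monicXsubC // size_XsubC addn2 ltnS => sg.
  by rewrite coefZ nth_default ?mulr0.
move=> i iN; have -> : p`_i`_(N.+1 - i) = f`_i by rewrite coef_poly ltnS iN.
rewrite fE mulrBr coefB coefMX coefMC coefZ; congr (_ - _); last by field.
by case: (i) => //= i'; rewrite coefZ mulVKf.
Qed.

End Homogeneous.

(** * Adjugates of matrices of corank one *)

Section Adjugate.
Variable F : fieldType.

(** Deleting a row and a column leaves a matrix that still factors through [col_base A] and
    [row_base A], so a rank below n - 1 makes every cofactor vanish. *)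
Lemma adj_neq0_rank n (A : 'M[F]_n) : \adj A != 0 -> (n.-1 <= \rank A)%N.
Proof.
apply: contraR; rewrite -ltnNge => rkA; apply/eqP/matrixP => i j.
rewrite !mxE /cofactor (_ : \det _ = 0) ?mulr0 //; apply/eqP.
apply/det0P.
set A' := row' _ _.
suff : (\rank A' < n.-1)%N.
  rewrite -subn_gt0 -mxrank_ker lt0n mxrank_eq0 => /rowV0Pn[v /sub_kermxP vA vn0].
  by exists v.
apply: leq_ltn_trans rkA.
have -> : A' = row' j (col_base A) *m col' i (row_base A).
  rewrite /A' -[in LHS](mulmx_base A).
  by apply/matrixP => u v; rewrite !mxE; apply: eq_bigr => w _; rewrite !mxE.
exact: leq_trans (mxrankM_maxl _ _) (rank_leq_col _).
Qed.

(** Both kernels have dimension at most one. As A adj A = 0, the columns of the adjugate are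
    multiples of [x]; as (adj A) A = 0, the row of their coefficients is a multiple of [y]. *)
Lemma adj_rank1 n (A : 'M[F]_n) (x : 'cV[F]_n) (y : 'rV[F]_n) :
  \adj A != 0 -> x != 0 -> y != 0 -> A *m x = 0 -> y *m A = 0 ->
  exists2 c, c != 0 & \adj A = c *: (x *m y).
Proof.
move=> An0 xn0 yn0 Ax yA.
have n0 : (0 < n)%N.
  by case: n x xn0 {A An0 Ax y yn0 yA} => // x; rewrite (flatmx0 x) eqxx.
have rkA : (n - \rank A <= 1)%N by have := adj_neq0_rank An0; lia.
have ker1 (B : 'M[F]_n) (v w : 'rV[F]_n) : (n - \rank B <= 1)%N -> v != 0 ->
    v *m B = 0 -> w *m B = 0 -> exists c, w = c *: v.
  move=> rkB vn0 /sub_kermxP vB /sub_kermxP wB; apply/sub_rVP.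
  apply: submx_trans wB _.
  by rewrite -(geq_leqif (mxrank_leqif_sup vB)) mxrank_ker rank_rV vn0.
have detA : \det A = 0 by apply/eqP/det0P; exists y.
have [z zE] : exists z : 'rV[F]_n, \adj A = x *m z.
  have colx j : exists c, col j (\adj A) = c *: x.
    have [||||c cE] := @ker1 A^T x^T (col j (\adj A))^T _ _ _ _.
    - by rewrite mxrank_tr.
    - by rewrite -trmx0 (inj_eq trmx_inj).
    - by rewrite -trmx_mul Ax trmx0.
    - by rewrite -trmx_mul colE mulmxA mul_mx_adj detA -scalemx1 scale0r mul0mx trmx0.
    by exists c; apply: trmx_inj; rewrite cE linearZ.
  have /choice[z zE] := colx.
  exists (\row_j z j); apply/matrixP => i j; rewrite !mxE big_ord1 !mxE.
  by have /colP/(_ i) := zE j; rewrite !mxE mulrC => ->.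
have [c zc] : exists c, z = c *: y.
  apply: (ker1 A) => //; have : x *m (z *m A) = 0.
    by rewrite mulmxA -zE mul_adj_mx detA -scalemx1 scale0r.
  have /cV0Pn[i xi] := xn0.
  move=> /matrixP xzA; apply/rowP => j; have := xzA i j.
  by rewrite !mxE big_ord1 => /eqP; rewrite mulf_eq0 (negPf xi) => /eqP; rewrite mxE.
exists c; last by rewrite zE zc -scalemxAr.
by apply: contraNneq An0 => c0; rewrite zE zc c0 scale0r mulmx0.
Qed.

(** Differentiate M adj M = (det M) I at 0 and multiply by [v] on the left: the term with the
    derivative of adj M contains v M(0) = 0. *)
Lemma deriv_det_adj n (M : 'M[{poly F}]_n) (v : 'rV[F]_n) :
  let M0 := map_mx (fun p : {poly F} => p.[0]) M in
  v *m M0 = 0 ->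
  v *m map_mx (fun p : {poly F} => p^`().[0]) M *m \adj M0
    = (\det M)^`().[0] *: v.
Proof.
move=> M0 vM.
have adjE : \adj M0 = map_mx (horner_eval 0) (\adj M) by rewrite map_mx_adj.
have /matrixP MadjM := mul_mx_adj M.
apply/rowP => j; rewrite -mulmxA adjE.
have -> : map_mx (fun p : {poly F} => p^`().[0]) M *m map_mx (horner_eval 0) (\adj M)
  = ((\det M)^`().[0])%:M - M0 *m map_mx (fun p : {poly F} => p^`().[0]) (\adj M).
  apply/matrixP => i k; have /(congr1 (fun p => p^`().[0])) := MadjM i k.
  rewrite !mxE derivMn hornerMn => <-; rewrite raddf_sum horner_sum.
  rewrite -sumrB; apply: eq_bigr => u _.
  by rewrite /M0 ![map_mx _ _ _ _]mxE /horner_eval /= derivM hornerD !hornerM; ring.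
by rewrite mulmxBr mulmxA vM mul0mx subr0 mul_mx_scalar.
Qed.

End Adjugate.

(** * The matrix polynomial along the normal line; simple eigenvalues and simple roots *)

Section Pencil.
Variables (R : realType) (n k : nat).
Local Notation C := R[i].
Implicit Types (B dB : 'I_k.+1 -> 'M[C]_n) (l : C * C).

Lemma entry_hmxpoly B u v :
  hmxpoly B u v
  = \sum_(i < k.+1) 'X^i * 'Y ^+ (k - i) * (B i u v)%:P%:P.
Proof. by rewrite /hmxpoly summxE; apply: eq_bigr => i _; rewrite !mxE. Qed.

Lemma homog_det_hmxpoly B : homog (n * k)%N (\det (hmxpoly B)).
Proof.
apply: homog_det => u v; rewrite entry_hmxpoly; apply: homog_sum => i _.
have := homogM (homogM (homogXn (m := i) (@homogX C)) (homogXn (m := k - i) (@homogY C)))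
               (homogC (B i u v)).
by rewrite !muln1 addn0 subnKC // -ltnS.
Qed.

Definition normal_dir l : C * C := (Num.conj l.2, - Num.conj l.1).

Definition line_pt l (t : C) : C * C :=
  (l.1 + Num.conj l.2 * t, l.2 + - Num.conj l.1 * t).

Definition mxline B l : 'M[{poly C}]_n := map_mx (along l (normal_dir l)) (hmxpoly B).

Definition detline B l : {poly C} := \det (mxline B l).

Lemma detlineE B l : detline B l = along l (normal_dir l) (\det (hmxpoly B)).
Proof. exact: det_along. Qed.

Lemma evalmx_det B l : (\det (hmxpoly B)).[l.1, l.2] = \det (evalmx (hmxpoly B) l).
Proof.
have -> : evalmx (hmxpoly B) l
  = map_mx (horner_eval l.2) (map_mx (horner_eval l.1%:P) (hmxpoly B)).
  by rewrite -map_mx_comp.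
by rewrite !det_map_mx.
Qed.

Lemma horner_mxline B l t :
  map_mx (fun p : {poly C} => p.[t]) (mxline B l) = evalmx (hmxpoly B) (line_pt l t).
Proof. by apply/matrixP => u v; rewrite !mxE horner_along. Qed.

Lemma line_pt0 l : line_pt l 0 = l.
Proof. by rewrite /line_pt !mulr0 !addr0 -surjective_pairing. Qed.

Lemma horner_detline B l t :
  (detline B l).[t] = \det (evalmx (hmxpoly B) (line_pt l t)).
Proof. by rewrite detlineE horner_along -evalmx_det. Qed.

Definition dmx B l : 'M[C]_n :=
  Num.conj l.2 *: evalmx (Dalpha (hmxpoly B)) l
    - Num.conj l.1 *: evalmx (Dbeta (hmxpoly B)) l.

Lemma deriv_mxline B l :
  map_mx (fun p : {poly C} => p^`().[0]) (mxline B l) = dmx B l.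
Proof.
apply/matrixP => u v; rewrite /dmx /mxline /evalmx /Dalpha /Dbeta !mxE.
by rewrite deriv_along0 /= mulNr.
Qed.

Definition sqn l : R := cabs l.1 ^+ 2 + cabs l.2 ^+ 2.

Lemma sqnE l : (sqn l)%:C%C = l.1 * Num.conj l.1 + l.2 * Num.conj l.2.
Proof. by rewrite !mul_conj -rmorphD. Qed.

Lemma sqn_gt0 l : l != (0, 0) -> 0 < sqn l.
Proof.
case: l => a b ab0; rewrite lt0r addr_ge0 ?sqr_ge0 // andbT.
rewrite paddr_eq0 ?sqr_ge0 // !sqrf_eq0 !cabs_eq0; exact: ab0.
Qed.

(** The dictionary between the two notions of multiplicity: for nonzero [l], the form of the line
    through l + r n restricts to a polynomial with the single simple root r. *)
Lemma along_line_form l (r : C) :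
  along l (normal_dir l) (line_form (line_pt l r)) = (sqn l)%:C%C *: ('X - r%:P).
Proof.
rewrite /line_form sqnE alongB !alongM !alongC alongX alongY /=.
rewrite -!mul_polyC !(rmorphD, rmorphM, rmorphN) /=; ring.
Qed.

Lemma line_pt_neq0 l r : l != (0, 0) -> line_pt l r != (0, 0).
Proof.
move=> /sqn_gt0 l0; apply: contraTneq l0 => s0.
have := along_line_form l r; rewrite s0 /line_form /= !rmorph0 !mul0r subrr.
rewrite along0 => /esym/eqP; rewrite scaler_eq0 polyXsubC_eq0 orbF.
by rewrite fmorph_eq0 => /eqP ->; rewrite ltxx.
Qed.

(** A double root at 0 would make the cofactor of [line_form l] vanish at [l]; being homogeneous, it
    would be divisible by [line_form l] again, against multiplicity one. *)
Lemma simple_detline B l : simple_eigenvalue B l ->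
  (detline B l).[0] = 0 /\ (detline B l)^`().[0] != 0.
Proof.
move=> [[l0 detl] [[q qE] nq2]]; rewrite expr1 in qE.
have hdet := homog_det_hmxpoly B.
split; first by rewrite detlineE horner_along0.
have l00 : (l.1, l.2) != (0, 0) by rewrite -surjective_pairing.
have [q' hq' q'E] := homog_factor l00 hdet detl.
apply/negP => /eqP d0; apply: nq2.
have q'l : q'.[l.1, l.2] = 0.
  have := along_line_form l 0; rewrite line_pt0 subr0 => aL.
  move: d0; rewrite detlineE (q'E : _ = line_form l * q') alongM aL -scalerAl.
  rewrite derivZ hornerZ derivM derivX mul1r hornerD hornerM hornerX mul0r addr0.
  rewrite horner_along0 => /eqP; rewrite mulf_eq0 => /orP[|/eqP //].
  by rewrite fmorph_eq0 => /eqP s0; have := sqn_gt0 l0; rewrite s0 ltxx.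
have [q2 _ q2E] := homog_factor l00 hq' q'l.
by exists q2; rewrite q'E q2E expr2 mulrA.
Qed.

(** In the converse direction, a second factor of the form would restrict to a double root at [r],
    where the derivative would vanish. *)
Lemma simple_line_pt B l r : l != (0, 0) ->
  (detline B l).[r] = 0 -> (detline B l)^`().[r] != 0 ->
  simple_eigenvalue B (line_pt l r).
Proof.
move=> l0 pr p'r; have m0 := line_pt_neq0 r l0.
have detm : (\det (hmxpoly B)).[(line_pt l r).1, (line_pt l r).2] = 0.
  by rewrite evalmx_det -horner_detline.
split; first by [].
have hdet := homog_det_hmxpoly B.
have [|q _ qE] := homog_factor _ hdet detm; first by rewrite -surjective_pairing.
split; first by exists q; rewrite expr1.
case=> q2 q2E; case/negP: p'r.
rewrite detlineE q2E alongM along_exp along_line_form expr2.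
by rewrite !derivE !hornerE /= !(subrr, mulr0, mul0r, addr0).
Qed.

End Pencil.

(** * Lipschitz bounds for determinants and adjugates *)

Section DetLipschitz.
Variables (R : realType) (V : comNzRingType) (N : V -> R).

(** Abstract because it serves twice: with the modulus on C, to compare adjugates, and with a
    coefficient norm on polynomials in t, to compare determinants along the normal line. *)
Definition ring_norm : Prop :=
  [/\ forall x, 0 <= N x, N 0 = 0, N 1 = 1, forall x, N (- x) = N x
    & (forall x y, N (x + y) <= N x + N y) /\ (forall x y, N (x * y) <= N x * N y)].

Hypothesis normN : ring_norm.

Lemma ring_norm_sum (I : Type) (r : seq I) (P : pred I) (F : I -> V) :
  N (\sum_(i <- r | P i) F i) <= \sum_(i <- r | P i) N (F i).
Proof.
case: normN => _ N0 _ _ [ND _].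
apply: (big_ind2 (fun z (s : R) => N z <= s)) => //; first by rewrite N0.
by move=> z s u t zs ut; apply: le_trans (ND _ _) (lerD zs ut).
Qed.

(** Telescoping, f0 f - g0 g = (f0 - g0) f + g0 (f - g); the induction also carries the bound on the
    product. [1 <= K] lets one power of K serve for all terms. *)
Lemma prod_lipschitz n (K e : R) (F G : 'I_n -> V) : 1 <= K -> 0 <= e ->
  (forall i, N (F i) <= K) -> (forall i, N (G i) <= K) ->
  (forall i, N (F i - G i) <= e) ->
  N (\prod_i F i - \prod_i G i) <= n%:R * K ^+ n * e.
Proof.
case: normN => Nge0 N0 N1 NN [ND NM] K1 e0.
have K0 : 0 <= K by apply: le_trans K1.
suff : forall F G : 'I_n -> V,
  (forall i, N (F i) <= K) -> (forall i, N (G i) <= K) ->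
  (forall i, N (F i - G i) <= e) ->
  N (\prod_i F i) <= K ^+ n /\ N (\prod_i F i - \prod_i G i) <= n%:R * K ^+ n * e.
  by move=> h FK GK FG; case: (h F G FK GK FG).
elim: n {F G} => [|n IH] F G FK GK FG.
  by rewrite !big_ord0 subrr N0 N1 !mul0r.
rewrite !big_ord_recl.
have [] := IH (fun i => F (lift ord0 i)) (fun i => G (lift ord0 i)) => //.
set f := \prod_i _; set g := \prod_i _ => fK fg.
split; first by rewrite exprS (le_trans (NM _ _)) // ler_pM.
have -> : F ord0 * f - G ord0 * g = (F ord0 - G ord0) * f + G ord0 * (f - g) by ring.
apply: le_trans (ND _ _) _.
apply: (@le_trans _ _ (e * K ^+ n + K * (n%:R * K ^+ n * e))).
  by apply: lerD; apply: le_trans (NM _ _) _; apply: ler_pM.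
rewrite exprS -[n.+1]add1n natrD.
have : e * K ^+ n <= K * (e * K ^+ n).
  by rewrite ler_peMl // mulr_ge0 // exprn_ge0.
lra.
Qed.

Lemma det_lipschitz n (K : R) : 1 <= K -> exists2 L : R, 0 <= L &
  forall (e : R) (A A' : 'M[V]_n), 0 <= e ->
    (forall i j, N (A i j) <= K) -> (forall i j, N (A' i j) <= K) ->
    (forall i j, N (A i j - A' i j) <= e) ->
    N (\det A - \det A') <= L * e.
Proof.
case: normN => Nge0 N0 N1 NN [ND NM] K1.
have K0 : 0 <= K by apply: le_trans K1.
exists (\sum_(s : 'S_n) n%:R * K ^+ n).
  by apply: sumr_ge0 => s _; rewrite mulr_ge0 // exprn_ge0.
move=> e A A' e0 AK A'K AA'.
rewrite /determinant -sumrB (le_trans (ring_norm_sum _ _ _)) // mulr_suml.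
apply: ler_sum => s _; rewrite -mulrBr (le_trans (NM _ _)) //.
have -> : N ((-1) ^+ s) = 1.
  by case: (s : bool); rewrite ?expr1 ?expr0 ?NN N1.
by rewrite mul1r prod_lipschitz.
Qed.

Lemma adj_lipschitz n (K : R) : 1 <= K -> exists2 L : R, 0 <= L &
  forall (e : R) (A A' : 'M[V]_n), 0 <= e ->
    (forall i j, N (A i j) <= K) -> (forall i j, N (A' i j) <= K) ->
    (forall i j, N (A i j - A' i j) <= e) ->
    forall i j, N (\adj A i j - \adj A' i j) <= L * e.
Proof.
move=> K1; have [L L0 detL] := @det_lipschitz n.-1 K K1; exists L => //.
case: normN => Nge0 N0 N1 NN [ND NM].
move=> e A A' e0 AK A'K AA' i j; rewrite !mxE /cofactor -mulrBr.
rewrite (le_trans (NM _ _)) // -signr_odd.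
have -> : N ((-1) ^+ odd (j + i)) = 1.
  by case: (odd _); rewrite ?expr1 ?expr0 ?NN N1.
by rewrite mul1r detL // => u v; rewrite !mxE.
Qed.

End DetLipschitz.

(** * The coefficient norm on polynomials and Taylor remainders *)

Section PolyNorm.
Variable R : realType.
Local Notation C := R[i].
Implicit Types p q : {poly C}.

Lemma ring_norm_cabs : ring_norm (@cabs R).
Proof.
split; [exact: cabs_ge0|exact: cabs0|exact: cabs1|exact: cabsN|].
by split=> [x y|x y]; rewrite ?cabsD ?cabsM.
Qed.

(** The l1 norm of the coefficients: submultiplicative, and an upper bound for the values on the
    closed unit disc. *)
Definition pnorm p : R := \sum_(i < size p) cabs p`_i.

Lemma pnormE m p : (size p <= m)%N -> pnorm p = \sum_(i < m) cabs p`_i.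
Proof.
move=> sp; rewrite /pnorm (big_ord_widen _ (fun i => cabs p`_i) sp) big_mkcond /=.
apply: eq_bigr => i _; case: ltnP => // pi.
by rewrite nth_default // cabs0.
Qed.

Lemma pnorm_ge0 p : 0 <= pnorm p.
Proof. by apply: sumr_ge0 => i _; apply: cabs_ge0. Qed.

Lemma pnorm0 : pnorm 0 = 0.
Proof. by rewrite /pnorm size_poly0 big_ord0. Qed.

Lemma pnormN p : pnorm (- p) = pnorm p.
Proof. by rewrite /pnorm size_polyN; apply: eq_bigr => i _; rewrite coefN cabsN. Qed.

Lemma pnormD p q : pnorm (p + q) <= pnorm p + pnorm q.
Proof.
set m := maxn (size p) (size q).
rewrite (@pnormE m (p + q)) ?size_polyD // (@pnormE m p) ?leq_maxl //.
rewrite (@pnormE m q) ?leq_maxr // -big_split /=; apply: ler_sum => i _.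
by rewrite coefD cabsD.
Qed.

Lemma pnormMXaddC p c : pnorm (p * 'X + c%:P) = pnorm p + cabs c.
Proof.
rewrite (@pnormE (size p).+1); last first.
  rewrite size_MXaddC; case: ifP => // /andP[/eqP -> _]; by rewrite size_poly0.
rewrite big_ord_recl coefD coefMX coefC /= add0r addrC; congr (_ + _).
by apply: eq_bigr => i _; rewrite coefD coefMX coefC addr0.
Qed.

Lemma pnormMX p : pnorm (p * 'X) = pnorm p.
Proof. by have := pnormMXaddC p 0; rewrite addr0 cabs0 addr0. Qed.

Lemma pnormC c : pnorm c%:P = cabs c.
Proof. by have := pnormMXaddC 0 c; rewrite mul0r add0r pnorm0 add0r. Qed.

Lemma pnormZ c p : pnorm (c *: p) = cabs c * pnorm p.
Proof.
rewrite (@pnormE (size p)) ?size_scale_leq // mulr_sumr.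
by apply: eq_bigr => i _; rewrite coefZ cabsM.
Qed.

Lemma pnormM p q : pnorm (p * q) <= pnorm p * pnorm q.
Proof.
elim/poly_ind: p => [|p c IH]; first by rewrite mul0r pnorm0 mul0r.
rewrite mulrDl -mulrA -commr_polyX mulrA (le_trans (pnormD _ _)) //.
by rewrite pnormMX mul_polyC pnormZ pnormMXaddC mulrDl lerD.
Qed.

Lemma ring_norm_pnorm : ring_norm pnorm.
Proof.
split; [exact: pnorm_ge0|exact: pnorm0|by rewrite pnormC cabs1|exact: pnormN|].
by split; [exact: pnormD|exact: pnormM].
Qed.

Lemma cabs_horner p t : cabs t <= 1 -> cabs p.[t] <= pnorm p.
Proof.
move=> t1; elim/poly_ind: p => [|p c IH]; first by rewrite horner0 cabs0 pnorm0.
rewrite !hornerE pnormMXaddC (le_trans (cabsD _ _)) // lerD // cabsM.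
by rewrite (le_trans _ IH) // ler_piMr ?cabs_ge0.
Qed.

Lemma cabs_horner_sub p t : cabs t <= 1 -> cabs (p.[t] - p.[0]) <= cabs t * pnorm p.
Proof.
move=> t1; elim/poly_ind: p => [|p c _]; first by rewrite !horner0 subrr cabs0 pnorm0 mulr0.
rewrite !hornerE pnormMXaddC (_ : _ - _ = t * p.[t]); last by ring.
rewrite cabsM ler_wpM2l ?cabs_ge0 // (le_trans (cabs_horner _ t1)) //.
by rewrite lerDl cabs_ge0.
Qed.

(** Writing p = p1 X + c, the remainder is t (p1(t) - p1(0)), to which the first-order bound
    applies. *)
Lemma cabs_horner_taylor p t : cabs t <= 1 ->
  cabs (p.[t] - p.[0] - t * p^`().[0]) <= cabs t ^+ 2 * pnorm p.
Proof.
move=> t1; elim/poly_ind: p => [|p c _].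
  by rewrite deriv0 !horner0 mulr0 !subr0 cabs0 pnorm0 mulr0.
rewrite !derivE !hornerE pnormMXaddC.
rewrite (_ : _ - _ = t * (p.[t] - p.[0])); last by ring.
rewrite cabsM expr2 -mulrA ler_wpM2l ?cabs_ge0 //.
rewrite (le_trans (cabs_horner_sub _ t1)) // ler_wpM2l ?cabs_ge0 //.
by rewrite lerDl cabs_ge0.
Qed.

Lemma pnorm_deriv D p : (size p <= D.+1)%N -> pnorm p^`() <= D%:R * pnorm p.
Proof.
move=> sp; rewrite (@pnormE D); last first.
  by apply: leq_trans (size_poly _ _) _; rewrite -ltnS; case: (size p) sp.
rewrite (pnormE sp) big_ord_recl mulrDr mulr_sumr -[leLHS]add0r lerD //.
  by rewrite mulr_ge0 // cabs_ge0.
apply: ler_sum => i _; rewrite coef_deriv -[_ *+ _]mulr_natl cabsM.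
rewrite ler_wpM2r ?cabs_ge0 // -(rmorph_nat (@real_complex_def _ (Phant R))) cabsR // ler_nat.
exact: ltn_ord.
Qed.

End PolyNorm.

(** * A root near 0 from the logarithmic derivative *)

Section SmallRoot.
Variable R : realType.
Local Notation C := R[i].

(** The estimate on p'/p is multiplied out, so that a root at 0 needs no exception and the product
    rule drives the induction. *)
Lemma prod_deriv_bound (s : seq C) (m : R) : 0 <= m ->
  (forall r, r \in s -> m <= cabs r) ->
  m * cabs (\prod_(r <- s) ('X - r%:P))^`().[0]
    <= (size s)%:R * cabs (\prod_(r <- s) ('X - r%:P)).[0].
Proof.
move=> m0; elim: s => [|r s IH] ms.
  by rewrite big_nil derivE horner0 cabs0 mulr0 mul0r.
rewrite big_cons; set q := \prod_(j <- s) _.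
have {}IH : m * cabs q^`().[0] <= (size s)%:R * cabs q.[0].
  by apply: IH => u us; rewrite ms // inE us orbT.
have mr : m <= cabs r by rewrite ms // inE eqxx.
rewrite derivM derivXsubC !hornerE.
apply: (@le_trans _ _ (m * (cabs q.[0] + cabs r * cabs q^`().[0]))).
  by rewrite ler_wpM2l // (le_trans (cabsD _ _)) // cabsM cabsN.
rewrite cabsM cabsN /= -[(size s).+1]add1n natrD.
have := ler_wpM2l (cabs_ge0 r) IH; have := ler_wpM2r (cabs_ge0 q.[0]) mr.
lra.
Qed.

(* p'/p is the sum of the 1/(X - r) over the roots r, so if all of them had modulus
   at least m, then m |p'(0)| would be at most deg p times |p(0)|. *)
Lemma small_root (p : {poly C}) D : (size p <= D.+1)%N -> p^`().[0] != 0 ->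
  exists2 r, p.[r] = 0 & cabs r * cabs p^`().[0] <= 2 * D%:R * cabs p.[0].
Proof.
move=> sp p'0; have [p0|p0] := eqVneq p.[0] 0.
  by exists 0 => //; rewrite cabs0 mul0r !mulr_ge0 ?cabs_ge0 // ler0n.
apply: contrapT => noroot.
have [s pE] := closed_field_poly_normal p.
have lp0 : lead_coef p != 0.
  by rewrite lead_coef_eq0; apply: contraNneq p0 => ->; rewrite horner0.
have ss : (size s <= D)%N.
  by move: sp; rewrite pE size_scale // size_prod_XsubC.
have dp : 0 < cabs p^`().[0] by rewrite cabs_gt0.
have pp : 0 < cabs p.[0] by rewrite cabs_gt0.
(* The factor 2 makes m |p'(0)| <= D |p(0)| contradictory, since D |p(0)| > 0. *)
set m := 2 * D%:R * cabs p.[0] / cabs p^`().[0].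
have m0 : 0 <= m by rewrite !mulr_ge0 ?invr_ge0 ?cabs_ge0 // ler0n.
have D0 : (0 < D)%N.
  case: (D) sp => // /size1_polyC pC; move: p'0; by rewrite pC derivC horner0 eqxx.
have := @prod_deriv_bound s m m0.
case: (pselect (forall r, r \in s -> m <= cabs r)) => [ms /(_ ms)|nms _]; last first.
  apply: nms => r rs; rewrite leNgt; apply/negP => rm; apply: noroot.
  exists r; last by rewrite -ler_pdivlMr // ltW.
  by apply/rootP; rewrite pE rootZ // root_prod_XsubC.
set q := \prod_(r <- s) _ => mq.
have : m * cabs p^`().[0] <= D%:R * cabs p.[0].
  rewrite pE derivZ !hornerZ !cabsM -/q mulrCA [leRHS]mulrCA ler_wpM2l ?cabs_ge0 //.
  by rewrite (le_trans mq) // ler_wpM2r ?cabs_ge0 // ler_nat.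
rewrite /m divfK ?gt_eqF //.
have : 0 < D%:R * cabs p.[0] by rewrite mulr_gt0 // ltr0n.
lra.
Qed.

End SmallRoot.

(** * Degrees along a line, and entrywise matrix bounds *)

Section SizeAlong.
Variable K : fieldType.

Lemma size_along_homog (l d : K * K) N p :
  homog N p -> (size (along l d p) <= N.+1)%N.
Proof.
move=> /dehomK <-; rewrite /hpoly poly_def along_sum.
apply: leq_trans (size_sum _ _ _) _; apply/bigmax_leqP => i _.
have iN : (i <= N)%N by rewrite -ltnS.
rewrite -mul_polyC alongM along_exp alongX -[_ *: 'X^_]mul_polyC.
rewrite rmorphM rmorphXn /= alongM along_exp alongC alongY.
have sg (a b : K) m : (size ((a%:P + b *: 'X) ^+ m) <= m.+1)%N.
  apply: leq_trans (size_poly_exp_leq _ _) _; rewrite ltnS -[leqRHS]mul1n leq_mul2r.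
  apply/orP; right; rewrite -subn1 leq_subLR.
  rewrite addrC -mul_polyC size_MXaddC; case: ifP => // _.
  by rewrite ltnS size_polyC leq_b1.
apply: leq_trans (size_polyMleq _ _) _.
have := sg l.1 d.1 i; have := sg l.2 d.2 (N - i)%N.
set g := _ ^+ _; set h := _ ^+ _ => hg hh.
rewrite mul_polyC; have := size_scale_leq (dehom N p)`_i g.
move=> /leq_trans/(_ hg) hs; have := leq_add hs hh.
by rewrite addSn addnS subnK //; case: (size _ + size _)%N.
Qed.

End SizeAlong.

Section MatrixBounds.
Variable R : realType.
Local Notation C := R[i].

(** Entrywise bounds suffice because only the order of the errors in eps matters for the limit, not
    their constants. *)
Definition mxbound m n (A : 'M[C]_(m, n)) (e : R) := forall i j, cabs (A i j) <= e.

Lemma mxbound_mul m n p (A : 'M[C]_(m, n)) (A' : 'M[C]_(n, p)) e f :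
  mxbound A e -> mxbound A' f -> mxbound (A *m A') (n%:R * (e * f)).
Proof.
move=> Ae A'f i j; rewrite mxE (le_trans (cabs_sum _ _ _)) //.
apply: (@le_trans _ _ (\sum_(u < n) e * f)); last first.
  by rewrite sumr_const card_ord mulr_natl.
by apply: ler_sum => u _; rewrite cabsM ler_pM ?cabs_ge0.
Qed.

Lemma mxboundD m n (A A' : 'M[C]_(m, n)) e f :
  mxbound A e -> mxbound A' f -> mxbound (A + A') (e + f).
Proof. by move=> Ae A'f i j; rewrite mxE (le_trans (cabsD _ _)) // lerD. Qed.

Lemma mxbound_sum m n (A : 'M[C]_(m, n)) : mxbound A (\sum_u \sum_v cabs (A u v)).
Proof.
move=> i j; rewrite (bigD1 i) //= (bigD1 j) //= -addrA lerDl.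
rewrite addr_ge0 //; first by apply: sumr_ge0 => ? _; apply: cabs_ge0.
by do 2![apply: sumr_ge0 => ? _]; apply: cabs_ge0.
Qed.

End MatrixBounds.

(** * Persistence of a simple root under perturbation *)

Section StableRoot.
Variable R : realType.
Local Notation C := R[i].

(** For small e, |q'(0)| is at least 3/4 of |p'(0)|, so [small_root] gives a root of size O(e); the
    derivative of [q] has moved little there too, so this root is simple. *)
Lemma stable_root (p : {poly C}) D (L : R) : 0 <= L -> (size p <= D.+1)%N ->
  p.[0] = 0 -> p^`().[0] != 0 ->
  exists2 e0 : R, 0 < e0 <= 1 & exists2 Q : R, 0 <= Q &
  forall (q : {poly C}) (e : R), 0 <= e <= e0 -> (size q <= D.+1)%N ->
    pnorm (q - p) <= L * e ->
    exists r, [/\ q.[r] = 0, q^`().[r] != 0 & cabs r <= Q * e].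
Proof.
move=> L0 sp p0 dp0.
have s0 : 0 < cabs p^`().[0] by rewrite cabs_gt0.
set s := cabs p^`().[0] in s0.
have D0 : 0 <= D%:R :> R by exact: ler0n.
(* [Q] comes from |r| (3/4) s <= 2 D L e, with 8/3 rounded up to 4. [T] e bounds the change of the
   derivative from p to q and from 0 to r together; W e <= 1 makes it at most s / 4. *)
have [Q QE] : {Q : R | Q = 4 * D%:R * L / s} by eexists.
have Q0 : 0 <= Q by rewrite QE !mulr_ge0 // invr_ge0 ltW.
have [T TE] : {T : R | T = D%:R * L + Q * pnorm p^`()} by eexists.
have T0 : 0 <= T by rewrite TE; apply: addr_ge0; apply: mulr_ge0 => //; apply: pnorm_ge0.
have [W WE] : {W : R | W = 4 * T / s} by eexists.
have W0 : 0 <= W by rewrite WE mulr_ge0 ?invr_ge0 ?mulr_ge0 // ltW.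
have den : 0 < 1 + Q + W by lra.
exists (1 + Q + W)^-1.
  rewrite invr_gt0 den invf_le1 //; lra.
exists Q => // q e /andP[e0 ee] sq0 pq.
have : e * (1 + Q + W) <= 1 by rewrite -ler_pdivlMr // mul1r.
rewrite !mulrDr mulr1 => eb.
have eQ := mulr_ge0 e0 Q0; have eW := mulr_ge0 e0 W0.
have e1 : e <= 1 by lra.
have Qe1 : Q * e <= 1 by lra.
have Te : T * e <= s / 4.
  have : e * W <= 1 by lra.
  rewrite WE mulrA ler_pdivrMr //; lra.
have cabs_01 : cabs (0 : C) <= 1 by rewrite cabs0.
have sq : (size (q - p)%R <= D.+1)%N.
  by rewrite (leq_trans (size_polyD _ _)) // size_polyN geq_max sq0.
have dpq t : cabs t <= 1 -> cabs (q^`().[t] - p^`().[t]) <= D%:R * L * e.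
  move=> t1; have -> : q^`().[t] - p^`().[t] = (q - p)^`().[t] by rewrite !derivE !hornerE.
  rewrite (le_trans (cabs_horner _ t1)) //.
  by rewrite (le_trans (pnorm_deriv sq)) // -mulrA ler_wpM2l.
have DLT : D%:R * L * e <= T * e.
  by rewrite TE ler_wpM2r // lerDl mulr_ge0 // pnorm_ge0.
have dq0 : 3 / 4 * s <= cabs q^`().[0].
  have := cabs_sub p^`().[0] q^`().[0]; rewrite -(cabsN (_ - _)) opprB.
  have := dpq 0 cabs_01; rewrite -/s; lra.
have dq0n : q^`().[0] != 0 by rewrite -cabs_gt0; lra.
have [r qr rb] := small_root sq0 dq0n.
have rQ : cabs r <= Q * e.
  have q0 : cabs q.[0] <= L * e.
    have -> : q.[0] = (q - p).[0] by rewrite !hornerE p0 subr0.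
    exact: le_trans (cabs_horner _ cabs_01) pq.
  have : cabs r * (3 / 4 * s) <= 2 * D%:R * (L * e).
    apply: le_trans (ler_wpM2l (cabs_ge0 r) dq0) _; apply: le_trans rb _.
    by rewrite ler_wpM2l // mulr_ge0.
  have -> : Q * e = 4 * D%:R * L * e / s by rewrite QE; field; rewrite gt_eqF.
  rewrite ler_pdivlMr //.
  have := mulr_ge0 (cabs_ge0 r) (ltW s0); have := mulr_ge0 (mulr_ge0 D0 L0) e0; lra.
exists r; split=> //.
have r1 : cabs r <= 1 by apply: le_trans rQ Qe1.
have : 0 < cabs q^`().[r]; last by rewrite cabs_gt0.
have := cabs_sub p^`().[0] p^`().[r]; rewrite -(cabsN (_ - _)) opprB.
have := cabs_sub p^`().[r] q^`().[r]; rewrite -(cabsN (_ - _)) opprB.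
have := dpq r r1.
have := cabs_horner_sub p^`() r1.
have : cabs r * pnorm p^`() <= Q * pnorm p^`() * e.
  by rewrite [leRHS]mulrAC ler_wpM2r ?pnorm_ge0.
have : T * e = D%:R * L * e + Q * pnorm p^`() * e by rewrite TE mulrDl.
rewrite -/s; lra.
Qed.

End StableRoot.

(** * Perturbed determinants along the normal line *)

Section Perturbation.
Variables (R : realType) (n k : nat).
Local Notation C := R[i].
Implicit Types (B dB : 'I_k.+1 -> 'M[C]_n) (l : C * C).

Lemma hmxpolyD B dB : hmxpoly (addcoef B dB) = hmxpoly B + hmxpoly dB.
Proof.
apply/matrixP => u v; rewrite mxE !entry_hmxpoly -big_split; apply: eq_bigr => i _.
by rewrite /= /addcoef mxE !rmorphD mulrDr.
Qed.

Lemma evalmx_hmxpolyD B dB l : evalmx (hmxpoly (addcoef B dB)) l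
  = evalmx (hmxpoly B) l + evalmx (hmxpoly dB) l.
Proof. by rewrite hmxpolyD; apply/matrixP => u v; rewrite !mxE !hornerD. Qed.

Lemma mxlineD B dB l : mxline (addcoef B dB) l = mxline B l + mxline dB l.
Proof. by rewrite /mxline hmxpolyD map_mxD. Qed.

Lemma evalmx_hmxpoly B l :
  evalmx (hmxpoly B) l = \sum_(i < k.+1) (l.1 ^+ i * l.2 ^+ (k - i)) *: B i.
Proof.
apply/matrixP => u v; rewrite mxE entry_hmxpoly summxE !horner_sum.
apply: eq_bigr => i _; by rewrite mxE !(hornerM, horner_exp, hornerX, hornerC).
Qed.

(** Homogeneity removes the scalar by which a chosen representative of a line differs from a point l
    + t n. *)
Lemma evalmx_scale B (c : C) l :
  evalmx (hmxpoly B) (c * l.1, c * l.2) = c ^+ k *: evalmx (hmxpoly B) l.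
Proof.
rewrite !evalmx_hmxpoly scaler_sumr; apply: eq_bigr => i _ /=.
have -> : c ^+ k = c ^+ i * c ^+ (k - i) by rewrite -exprD subnKC // -ltnS.
by rewrite scalerA !exprMn; congr (_ *: _); ring.
Qed.

Definition coefbound dB (e : R) := forall i, mxbound (dB i) e.

Lemma pnorm_mxline l : exists2 G : R, 0 <= G & forall dB e, coefbound dB e ->
  forall u v, pnorm (mxline dB l u v) <= G * e.
Proof.
exists (\sum_(i < k.+1) pnorm (along l (normal_dir l) ('X^i * 'Y ^+ (k - i)))).
  by apply: sumr_ge0 => i _; apply: pnorm_ge0.
move=> dB e dBe u v; rewrite mxE entry_hmxpoly along_sum mulr_suml.
apply: le_trans (ring_norm_sum (ring_norm_pnorm R) _ _ _) _; apply: ler_sum => i _.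
rewrite alongM alongC (le_trans (pnormM _ _)) // pnormC.
by rewrite ler_wpM2l ?pnorm_ge0 //; apply: dBe.
Qed.

Lemma mxline_bound B l : exists2 G : R, 0 <= G &
  forall u v, pnorm (mxline B l u v) <= G.
Proof.
have [G G0 GB] := pnorm_mxline l.
exists (G * \sum_i \sum_u \sum_v cabs (B i u v)).
  by rewrite mulr_ge0 //; do 3![apply: sumr_ge0 => ? _]; apply: cabs_ge0.
apply: GB => i u v; rewrite (bigD1 i) //=.
apply: le_trans (mxbound_sum (B i) u v) _; rewrite lerDl.
by do 3![apply: sumr_ge0 => ? _]; apply: cabs_ge0.
Qed.

(** [e <= 1] keeps the perturbed entries in a fixed ball, on which the determinant has a Lipschitz
    constant independent of [dB]. *)
Lemma detline_lipschitz B l : exists2 L : R, 0 <= L & forall dB e, 0 <= e <= 1 ->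
  coefbound dB e -> pnorm (detline (addcoef B dB) l - detline B l) <= L * e.
Proof.
have [G G0 Gl] := pnorm_mxline l; have [K K0 KB] := mxline_bound B l.
have [|L L0 LP] := det_lipschitz (ring_norm_pnorm R) n (_ : 1 <= 1 + K + G).
  by rewrite -addrA lerDl addr_ge0.
exists (L * G) => [|dB e /andP[e0 e1] dBe]; first exact: mulr_ge0.
rewrite -mulrA; apply: LP => [|u v|u v|u v].
- exact: mulr_ge0.
- rewrite mxlineD mxE (le_trans (pnormD _ _)) // lerD //.
    by rewrite (le_trans (KB u v)) // lerDr.
  by rewrite (le_trans (Gl _ _ dBe u v)) // ler_piMr.
- by rewrite (le_trans (KB u v)) // addrAC lerDr addr_ge0.
- by rewrite mxlineD mxE [mxline B l u v + _]addrC addrK; apply: Gl.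
Qed.

Lemma size_detline B l : (size (detline B l) <= (n * k).+1)%N.
Proof. by rewrite detlineE size_along_homog //; apply: homog_det_hmxpoly. Qed.

Lemma simple_root_line_pt B l : simple_eigenvalue B l ->
  exists2 e0 : R, 0 < e0 & exists2 Q : R, 0 <= Q &
  forall dB e, 0 <= e <= e0 -> coefbound dB e ->
    exists2 r, simple_eigenvalue (addcoef B dB) (line_pt l r) & cabs r <= Q * e.
Proof.
move=> sl; have [p0 dp0] := simple_detline sl; have [[l0 _] _] := sl.
have [L L0 LP] := detline_lipschitz B l.
have [e0 /andP[e0p e01] [Q Q0 hQ]] := stable_root L0 (size_detline B l) p0 dp0.
exists e0 => //; exists Q => // dB e /andP[ep ee] dBe.
have [||r [qr dqr rQ]] := hQ (detline (addcoef B dB) l) e _ (size_detline _ l).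
- by rewrite ep ee.
- by apply: LP => //; rewrite ep (le_trans ee).
by exists r => //; apply: simple_line_pt.
Qed.

End Perturbation.

(** * The first-order equation with a quadratic remainder *)

Section PolyTaylor.
Variable R : realType.
Implicit Types (p q : {poly R[i]}) (r : R[i]).

Lemma cabs_increment p q K G e r : 0 <= K -> 0 <= G -> 0 <= e -> cabs r <= 1 ->
  pnorm p <= K -> pnorm q <= G * e ->
  cabs (p.[r] + q.[r] - p.[0]) <= (K + G) * (cabs r + e).
Proof.
move=> K0 G0 e0 r1 pK qG.
have -> : p.[r] + q.[r] - p.[0] = (p.[r] - p.[0]) + q.[r] by ring.
rewrite (le_trans (cabsD _ _)) //.
have h1 := cabs_horner_sub p r1; have h2 := cabs_horner q r1.
move: h1 h2; set a := cabs (_ - _); set b := cabs q.[r] => h1 h2.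
have r0 := cabs_ge0 r; set c := cabs r in h1 r0 *; clearbody a b c.
have h3 := ler_wpM2l r0 pK.
have h5 := mulr_ge0 K0 e0; have h6 := mulr_ge0 G0 r0.
have -> : (K + G) * (c + e) = c * K + K * e + G * c + G * e by ring.
lra.
Qed.

(** Since [q] already has size e, its variation q(r) - q(0) is of order |r| e; only [p] is expanded
    to second order. *)
Lemma cabs_increment2 p q K G e r : 0 <= K -> 0 <= G -> 0 <= e -> cabs r <= 1 ->
  pnorm p <= K -> pnorm q <= G * e ->
  cabs (p.[r] + q.[r] - p.[0] - (r * p^`().[0] + q.[0]))
    <= (K + G) * (cabs r + e) ^+ 2.
Proof.
move=> K0 G0 e0 r1 pK qG.
have -> : p.[r] + q.[r] - p.[0] - (r * p^`().[0] + q.[0])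
    = (p.[r] - p.[0] - r * p^`().[0]) + (q.[r] - q.[0]) by ring.
rewrite (le_trans (cabsD _ _)) //.
have h1 := cabs_horner_taylor p r1; have h2 := cabs_horner_sub q r1.
move: h1 h2; set a := cabs (_ - _ - _); set b := cabs (_ - _) => h1 h2.
have r0 := cabs_ge0 r; set c := cabs r in h1 h2 r0 *; clearbody a b c.
have h3 := ler_wpM2l (sqr_ge0 c) pK; have h4 := ler_wpM2l r0 qG.
have h5 := mulr_ge0 K0 (mulr_ge0 r0 e0); have h6 := mulr_ge0 K0 (sqr_ge0 e).
have h7 := mulr_ge0 G0 (sqr_ge0 c); have h8 := mulr_ge0 G0 (sqr_ge0 e).
have h9 := mulr_ge0 G0 (mulr_ge0 r0 e0).
have -> : (K + G) * (c + e) ^+ 2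
    = c ^+ 2 * K + 2 * (K * (c * e)) + K * e ^+ 2
      + G * c ^+ 2 + c * (G * e) + G * (c * e) + G * e ^+ 2 by ring.
lra.
Qed.

End PolyTaylor.

Section FirstOrder.
Variables (R : realType) (n k : nat).
Local Notation C := R[i].
Implicit Types (B dB : 'I_k.+1 -> 'M[C]_n) (l : C * C).

Lemma adjmx_eq0 (y : 'cV[C]_n) : (adjmx y == 0) = (y == 0).
Proof.
apply/eqP/eqP => [/matrixP y0|->]; last by apply/matrixP => i j; rewrite !mxE rmorph0.
apply/colP => i; have /eqP := y0 0 i; rewrite !mxE fmorph_eq0.
by move/eqP.
Qed.

Lemma mx_subE m p (A A' : 'M[C]_(m, p)) i j : (A - A') i j = A i j - A' i j.
Proof. by rewrite !mxE. Qed.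

Lemma mx_addE m p (A A' : 'M[C]_(m, p)) i j : (A + A') i j = A i j + A' i j.
Proof. by rewrite !mxE. Qed.

Lemma mx_scaleE m p (r : C) (A : 'M[C]_(m, p)) i j : (r *: A) i j = r * A i j.
Proof. by rewrite mxE. Qed.

Lemma bilin_comb (u : 'rV[C]_n) (D F : 'M[C]_n) (x : 'cV[C]_n) r :
  (u *m (r *: D + F) *m x) 0 0 = r * (u *m D *m x) 0 0 + (u *m F *m x) 0 0.
Proof. by rewrite mulmxDr mulmxDl -scalemxAr -scalemxAl mx_addE mx_scaleE. Qed.

(** By [deriv_det_adj], y^* D adj P is a nonzero multiple of y^* when the eigenvalue is simple.
    Hence adj P is nonzero, so of the form c x y^* , and y^* D x = 0 would make the product
    vanish. *)
Lemma adj_simple B l (x y : 'cV[C]_n) : simple_eigenvalue B l ->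
  right_eigenvector B l x -> left_eigenvector B l y ->
  (adjmx y *m dmx B l *m x) 0 0 != 0 /\
  exists2 c, c != 0 & \adj (evalmx (hmxpoly B) l) = c *: (x *m adjmx y).
Proof.
move=> sl [xn0 Px] [yn0 yP]; have [_ dp0] := simple_detline sl.
have y0 : adjmx y != 0 by rewrite adjmx_eq0.
have := @deriv_det_adj _ _ (mxline B l) (adjmx y).
rewrite /= horner_mxline line_pt0 => /(_ yP); rewrite deriv_mxline -/(detline B l) => yD.
have yDn0 : adjmx y *m dmx B l *m \adj (evalmx (hmxpoly B) l) != 0.
  by rewrite yD scaler_eq0 negb_or dp0.
have adjn0 : \adj (evalmx (hmxpoly B) l) != 0.
  by apply: contraNneq yDn0 => ->; rewrite mulmx0.
have [c c0 cE] := adj_rank1 adjn0 xn0 y0 Px yP.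
split; last by exists c.
apply: contraNneq yDn0 => yDx; rewrite cE -scalemxAr mulmxA.
by rewrite [_ *m x]mx11_scalar yDx mul_scalar_mx scale0r scaler0.
Qed.

(** Let M be the perturbed value at l + r n. As y^* P = 0 and M adj M = 0, the linear part times adj
    P is, up to sign, a sum of two second-order terms: the linearization error of M - P times adj P,
    and (M - P)(adj M - adj P), each multiplied by y^* on the left. *)
Lemma first_order B l (x y : 'cV[C]_n) : simple_eigenvalue B l ->
  right_eigenvector B l x -> left_eigenvector B l y ->
  exists2 K : R, 0 <= K & forall dB r e, 0 <= e <= 1 -> cabs r <= 1 ->
    coefbound dB e ->
    \det (evalmx (hmxpoly (addcoef B dB)) (line_pt l r)) = 0 ->
    cabs (r * (adjmx y *m dmx B l *m x) 0 0
          + (adjmx y *m evalmx (hmxpoly dB) l *m x) 0 0) <= K * (cabs r + e) ^+ 2.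
Proof.
move=> sl xE yE; have [_ [c c0 adjE]] := adj_simple sl xE yE.
have [_ Px] := xE; have [yn0 yP] := yE.
have [G G0 Gl] := pnorm_mxline n k l; have [K0 K00 KB] := mxline_bound B l.
have [|L L0 Ladj] := adj_lipschitz (ring_norm_cabs R) n (_ : 1 <= 1 + K0 + G).
  by rewrite -addrA lerDl addr_ge0.
set P := evalmx (hmxpoly B) l in Px yP adjE *.
(* As adj P = c x y^* , a single nonzero entry of y^* suffices to recover the scalar y^* (r D + F) x
   from the row identity. *)
have [j yj0] : exists j, adjmx y 0 j != 0.
  by apply/rV0Pn; rewrite adjmx_eq0.
set a := cabs (c * adjmx y 0 j).
have a0 : 0 < a by rewrite cabs_gt0 mulf_neq0.
have [Ya [Ya0 Yb]] : exists Ya, 0 <= Ya /\ mxbound (adjmx y) Ya.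
  exists (norm2 y); split=> [|u v]; first exact: norm2_ge0.
  by rewrite ord1 !mxE cabsC cabs_le_norm2.
have [Za [Za0 Zb]] : exists Za, 0 <= Za /\ mxbound (\adj P) Za.
  exists (\sum_u \sum_v cabs (\adj P u v)); split; last exact: mxbound_sum.
  by do 2![apply: sumr_ge0 => ? _]; apply: cabs_ge0.
pose H := K0 + G.
have H0 : 0 <= H by exact: addr_ge0.
pose N : R := n%:R.
have N0 : 0 <= N by exact: ler0n.
exists ((N * (N * (Ya * H) * Za) + N * (N * (Ya * H) * (L * H))) / a).
  by rewrite mulr_ge0 ?invr_ge0 ?(ltW a0) // addr_ge0 // !mulr_ge0.
move=> dB r e /andP[e0 e1] r1 dBe detM.
set M := evalmx _ _ in detM; set T := _ + _.
set D := dmx B l in T *; set F := evalmx (hmxpoly dB) l in T *.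
set rho := cabs r + e.
have rho0 : 0 <= rho by rewrite addr_ge0 ?cabs_ge0.
have r0 := cabs_ge0 r.
have Gdb u v := Gl _ _ dBe u v.
have Ge : G * e <= G by rewrite ler_piMr.
have mlB u v t : (mxline B l u v).[t] = evalmx (hmxpoly B) (line_pt l t) u v.
  by rewrite -horner_mxline [RHS]mxE.
have mldB u v t : (mxline dB l u v).[t] = evalmx (hmxpoly dB) (line_pt l t) u v.
  by rewrite -horner_mxline [RHS]mxE.
have dml u v : (mxline B l u v)^`().[0] = D u v by rewrite /D -deriv_mxline [RHS]mxE.
have ME u v : M u v = (mxline B l u v).[r] + (mxline dB l u v).[r].
  rewrite /M evalmx_hmxpolyD mx_addE -(mlB u v r).
  rewrite -(mldB u v r).
  reflexivity.
have PE u v : P u v = (mxline B l u v).[0] by rewrite mlB line_pt0.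
have FE u v : F u v = (mxline dB l u v).[0] by rewrite mldB line_pt0.
have MP : mxbound (M - P) (H * rho).
  by move=> u v; rewrite mx_subE ME PE; apply: cabs_increment (KB u v) (Gdb u v) => //.
have MT : mxbound (M - P - (r *: D + F)) (H * rho ^+ 2).
  move=> u v; rewrite !mx_subE mx_addE mx_scaleE ME PE FE -dml.
  by apply: cabs_increment2 (KB u v) (Gdb u v).
have Zd : mxbound (\adj M - \adj P) (L * (H * rho)).
  move=> u v; rewrite mx_subE; apply: Ladj.
  - exact: mulr_ge0.
  - move=> s t; rewrite ME (le_trans (cabsD _ _)) //.
    apply: lerD.
      by rewrite (le_trans (cabs_horner _ r1)) // (le_trans (KB s t)) // lerDr.
    by rewrite (le_trans (cabs_horner _ r1)) // (le_trans (Gdb s t)).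
  - move=> s t; rewrite PE (le_trans (cabs_horner _ _)) ?cabs0 //.
    by rewrite (le_trans (KB s t)) // addrAC lerDr addr_ge0.
  - by move=> s t; rewrite -mx_subE; apply: MP.
have key : adjmx y *m (r *: D + F) *m \adj P
    = - (adjmx y *m (M - P - (r *: D + F)) *m \adj P
         + adjmx y *m (M - P) *m (\adj M - \adj P)).
  apply/eqP; rewrite -addr_eq0 addrA -mulmxDl -mulmxDr.
  rewrite [r *: D + F + _]addrC subrK.
  have -> : adjmx y *m (M - P) = adjmx y *m M by rewrite mulmxBr yP subr0.
  rewrite mulmxBr addrC subrK -mulmxA mul_mx_adj detM.
  by rewrite -scalemx1 scale0r mulmx0.
have keyl : (adjmx y *m (r *: D + F) *m \adj P) 0 j = T * (c * adjmx y 0 j).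
  rewrite adjE -scalemxAr mulmxA [_ *m x]mx11_scalar mul_scalar_mx !mx_scaleE.
  by rewrite /T -bilin_comb mulrCA.
rewrite mulrAC ler_pdivlMr // -cabsM -keyl key mxE cabsN.
have b1 := mxbound_mul (mxbound_mul Yb MT) Zb.
have b2 := mxbound_mul (mxbound_mul Yb MP) Zd.
apply: le_trans (mxboundD b1 b2 0 j) _.
by rewrite -/N le_eqVlt; apply/orP; left; apply/eqP; ring.
Qed.

End FirstOrder.

(** * Chordal distance along the normal line *)

Section Chordal.
Variable R : realType.
Local Notation C := R[i].
Implicit Types l m : C * C.

Lemma norm2_cvec2 l : norm2 (cvec2 l) = Num.sqrt (sqn l).
Proof. by rewrite /norm2 /sqn big_ord_recl big_ord1 !mxE. Qed.

Lemma dot_cvec2 l m :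
  (adjmx (cvec2 m) *m cvec2 l) 0 0 = Num.conj m.1 * l.1 + Num.conj m.2 * l.2.
Proof. by rewrite !mxE big_ord_recl big_ord1 !mxE. Qed.

Definition scale_pt (mu : C) l : C * C := (mu * l.1, mu * l.2).

Lemma sqn_scale_pt mu l : sqn (scale_pt mu l) = cabs mu ^+ 2 * sqn l.
Proof. by rewrite /sqn /= !cabsM !exprMn mulrDr. Qed.

Lemma sqn_line_pt l r : sqn (line_pt l r) = sqn l * (1 + cabs r ^+ 2).
Proof.
have rE : (1 + cabs r ^+ 2)%:C%C = 1 + r * Num.conj r by rewrite mul_conj rmorphD.
apply: complexI; rewrite rmorphM /= rE !sqnE /=.
by rewrite !(rmorphD, rmorphM, rmorphN) /= !conj_invol; ring.
Qed.

(* The tangent of the angle between the lines is |r|. *)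
Lemma chordal_line_pt l mu r : l != (0, 0) -> mu != 0 ->
  chordal l (scale_pt mu (line_pt l r)) = cabs r / Num.sqrt (1 + cabs r ^+ 2).
Proof.
move=> l0 mu0; have s0 := sqn_gt0 l0.
have m0 : 0 < cabs mu by rewrite cabs_gt0.
have r0 : 0 < 1 + cabs r ^+ 2 by rewrite ltr_pwDl ?sqr_ge0.
set h := Num.sqrt (1 + cabs r ^+ 2).
have h0 : 0 < h by rewrite sqrtr_gt0.
have h2 : h ^+ 2 = 1 + cabs r ^+ 2 by rewrite sqr_sqrtr // ltW.
have h1 : 1 <= h by rewrite -sqrtr1 ler_wsqrtr // lerDl sqr_ge0.
rewrite /chordal /angle dot_cvec2 !norm2_cvec2 sqn_scale_pt sqn_line_pt.
have -> : Num.conj (scale_pt mu (line_pt l r)).1 * l.1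
  + Num.conj (scale_pt mu (line_pt l r)).2 * l.2 = Num.conj mu * (sqn l)%:C%C.
  rewrite sqnE /= !(rmorphD, rmorphM, rmorphN) /= ?conj_invol; ring.
rewrite cabsM cabsC cabsR ?(ltW s0) // sqrtrM ?sqr_ge0 // sqrtr_sqr.
rewrite (ger0_norm (ltW m0)) sqrtrM ?(ltW s0) // -/h.
have -> : cabs mu * sqn l / (Num.sqrt (sqn l) * (cabs mu * (Num.sqrt (sqn l) * h))) = h^-1.
  have := sqr_sqrtr (ltW s0); set u := Num.sqrt _ => u2; rewrite -u2; field.
  by rewrite !gt_eqF // sqrtr_gt0.
have hi : 0 < h^-1 <= 1 by rewrite invr_gt0 h0 invf_le1.
rewrite sin_acos; last by case/andP: hi => hi ->; rewrite (le_trans _ (ltW hi)) // lerN10.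
rewrite -[RHS]ger0_norm ?divr_ge0 ?cabs_ge0 ?(ltW h0) // -sqrtr_sqr.
congr Num.sqrt; rewrite exprMn !exprVn.
have -> : cabs r ^+ 2 = h ^+ 2 - 1 by rewrite h2 addrC addKr.
by field; rewrite gt_eqF.
Qed.

(** From 1 <= sqrt (1 + |r|^2) <= 1 + |r|: the two quantities differ by O(|r|^2). *)
Lemma chordal_line_pt_bounds l mu r : l != (0, 0) -> mu != 0 ->
  cabs r <= (1 + cabs r) * chordal l (scale_pt mu (line_pt l r)) /\
  chordal l (scale_pt mu (line_pt l r)) <= cabs r.
Proof.
move=> l0 mu0; rewrite chordal_line_pt //; have r0 := cabs_ge0 r.
set h := Num.sqrt _.
have h1 : 1 <= h by rewrite -sqrtr1 ler_wsqrtr // lerDl sqr_ge0.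
have hp : 0 < h by apply: lt_le_trans h1.
have hr : h <= 1 + cabs r.
  rewrite -[leRHS]ger0_norm ?addr_ge0 // -sqrtr_sqr ler_wsqrtr //.
  have -> : (1 + cabs r) ^+ 2 = 1 + 2 * cabs r + cabs r ^+ 2 by ring.
  by rewrite lerD2r lerDl mulr_ge0.
split; last by rewrite ler_pdivrMr // ler_peMr.
by rewrite mulrA ler_pdivlMr // mulrC ler_wpM2r.
Qed.

(** The points l + t n miss only the line orthogonal to [l], at chordal distance 1, which 1/2
    excludes; 1/2 also turns |r| <= (1 + |r|) e into |r| <= 2 e. *)
Lemma chordal_near l m (e : R) : l != (0, 0) -> e <= 1 / 2 -> chordal l m <= e ->
  exists mu r, [/\ mu != 0, m = scale_pt mu (line_pt l r) & cabs r <= 2 * e].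
Proof.
move=> l0 e12 le; have s0 := sqn_gt0 l0; set s := (sqn l)%:C%C.
have sn0 : s != 0 by rewrite fmorph_eq0 gt_eqF.
(* [mu] is the coefficient of the Hermitian projection of [m] onto [l]; with [r] below, [mu * r] is
   the one along the normal direction. *)
pose mu := (m.1 * Num.conj l.1 + m.2 * Num.conj l.2) / s.
have mu0 : mu != 0.
  apply/eqP => mu0; move: le; rewrite /chordal /angle dot_cvec2.
  have -> : Num.conj m.1 * l.1 + Num.conj m.2 * l.2 = Num.conj (mu * s).
    by rewrite /mu divfK // !(rmorphD, rmorphM) /= !conj_invol.
  rewrite mu0 mul0r rmorph0 cabs0 mul0r sin_acos ?expr0n ?subr0 ?sqrtr1 /=; last lra.
  lra.
pose r := (m.1 * l.2 - m.2 * l.1) / (s * mu).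
have mE : m = scale_pt mu (line_pt l r).
  have sE : s = l.1 * Num.conj l.1 + l.2 * Num.conj l.2 by rewrite /s sqnE.
  have mus : mu * s = m.1 * Num.conj l.1 + m.2 * Num.conj l.2 by rewrite /mu divfK.
  have murs : mu * r * s = m.1 * l.2 - m.2 * l.1 by rewrite /r; field; rewrite mu0 sn0.
  rewrite [LHS]surjective_pairing /scale_pt /line_pt /=; congr (_, _);
    apply: (mulIf sn0).
    transitivity (mu * s * l.1 + Num.conj l.2 * (mu * r * s)); last by ring.
    by rewrite mus murs sE; ring.
  transitivity (mu * s * l.2 - Num.conj l.1 * (mu * r * s)); last by ring.
  by rewrite mus murs sE; ring.
exists mu, r; split=> //.
have [h1 _] := chordal_line_pt_bounds r l0 mu0; rewrite -mE in h1.
have r0 := cabs_ge0 r.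
have : (1 + cabs r) * chordal l m <= (1 + cabs r) * e by rewrite ler_wpM2l // addr_ge0.
have : cabs r * e <= cabs r * (1 / 2) by rewrite ler_wpM2l.
lra.
Qed.

End Chordal.

(** * Existence of the perturbed eigenvalue *)

Section ApproachingEigenvalue.
Variables (R : realType) (n k : nat).
Local Notation C := R[i].
Implicit Types (B dB : 'I_k.+1 -> 'M[C]_n) (l : C * C).

Lemma perturbed_eigenvalueP B l : simple_eigenvalue B l ->
  approaching_eigenvalue B l (perturbed_eigenvalue B l).
Proof.
move=> sl; apply: xgetPex.
have [e0 e0p [Q Q0 hQ]] := simple_root_line_pt sl; have [[l0 _] _] := sl.
pose sz dB : R := \sum_i specnorm (dB i).
(* The map is fixed before [e] is given, so the root is bounded through the size of [dB] itself. The
   default 0 of [xget] can only occur when [sz dB] exceeds [e0]. *)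
pose good dB : set C :=
  [set r | simple_eigenvalue (addcoef B dB) (line_pt l r) /\ cabs r <= Q * sz dB].
exists (fun dB => line_pt l (xget 0 (good dB))) => e ep.
have k0 : 0 < k.+1%:R :> R by rewrite ltr0n.
exists (Num.min (e0 / k.+1%:R) (e / ((Q + 1) * k.+1%:R))).
  by rewrite lt_min !divr_gt0 // mulr_gt0 // ltr_wpDl.
move=> dB dBd; set d := Num.min _ _ in dBd.
have szk : sz dB <= k.+1%:R * d.
  rewrite /sz mulr_natl -[X in _ *+ X]card_ord -sumr_const.
  by apply: ler_sum => i _; apply: dBd.
have sze0 : sz dB <= e0.
  by apply: le_trans szk _; rewrite mulrC -ler_pdivlMr // ge_min lexx.
have szQ : Q * sz dB <= e.
  have : sz dB <= e / (Q + 1).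
    apply: le_trans szk _; rewrite mulrC -ler_pdivlMr // -mulrA -invfM.
    by rewrite ge_min lexx orbT.
  rewrite ler_pdivlMr ?ltr_wpDl // => h.
  have : 0 <= sz dB by apply: sumr_ge0 => i _; apply: specnorm_ge0.
  lra.
have sz0 : 0 <= sz dB by apply: sumr_ge0 => i _; apply: specnorm_ge0.
have [||r rs rQ] := hQ dB (sz dB); first by rewrite sz0.
  move=> i u v; rewrite (le_trans (cabs_le_specnorm _ _ _)) // /sz (bigD1 i) //=.
  by rewrite lerDl; apply: sumr_ge0 => j _; apply: specnorm_ge0.
have [] : good dB (xget 0 (good dB)) by apply: xgetPex; exists r.
set r' := xget _ _ => r's r'Q; split=> //.
have [_] := chordal_line_pt_bounds r' l0 (oner_neq0 C).
rewrite /scale_pt !mul1r -surjective_pairing => /le_trans; apply.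
exact: le_trans szQ.
Qed.

End ApproachingEigenvalue.

(** * Evaluation of the Stewart-Sun condition number *)

Section KappaTheta.
Variables (R : realType) (n k : nat).
Local Notation C := R[i].
Implicit Types (B dB : 'I_k.+1 -> 'M[C]_n) (l : C * C).

Definition wsum (w : 'I_k.+1 -> R) l : R :=
  \sum_(i < k.+1) cabs l.1 ^+ i * cabs l.2 ^+ (k - i) * w i.

Lemma bilin_evalmx dB l (x y : 'cV[C]_n) :
  (adjmx y *m evalmx (hmxpoly dB) l *m x) 0 0
  = \sum_(i < k.+1) (l.1 ^+ i * l.2 ^+ (k - i)) * (adjmx y *m dB i *m x) 0 0.
Proof.
rewrite evalmx_hmxpoly mulmx_sumr mulmx_suml summxE; apply: eq_bigr => i _.
by rewrite -scalemxAr -scalemxAl mx_scaleE.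
Qed.

Lemma bilin_evalmx_le (w : 'I_k.+1 -> R) dB l (x y : 'cV[C]_n) (eps : R) :
  (forall i, specnorm (dB i) <= eps * w i) ->
  cabs ((adjmx y *m evalmx (hmxpoly dB) l *m x) 0 0)
    <= eps * (norm2 y * norm2 x * wsum w l).
Proof.
move=> dBw; rewrite bilin_evalmx (le_trans (cabs_sum _ _ _)) //.
rewrite /wsum 2!mulr_sumr; apply: ler_sum => i _.
rewrite !cabsM !cabsX; set z := _ * cabs l.2 ^+ _.
have z0 : 0 <= z by rewrite mulr_ge0 ?exprn_ge0 ?cabs_ge0.
have -> : eps * (norm2 y * norm2 x * (z * w i)) = z * (norm2 y * norm2 x * (eps * w i)).
  by ring.
rewrite ler_wpM2l // (le_trans (cabs_bilin _ _ _)) //.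
by rewrite ler_wpM2l // mulr_ge0 ?norm2_ge0.
Qed.

(* The extremal perturbation aligns the phases of the summands of
   [y^* dP(l) x]; at a vanishing monomial the phase is 0 since 0^-1 = 0. *)
Lemma extremal_perturbation (w : 'I_k.+1 -> R) l (x y : 'cV[C]_n) (eps : R) :
  0 <= eps -> (forall i, 0 <= w i) -> x != 0 -> y != 0 ->
  exists2 dB, (forall i, specnorm (dB i) <= eps * w i) &
    cabs ((adjmx y *m evalmx (hmxpoly dB) l *m x) 0 0)
      = eps * (norm2 y * norm2 x * wsum w l).
Proof.
move=> eps0 w0 x0 y0.
have nx : 0 < norm2 x by rewrite norm2_gt0.
have ny : 0 < norm2 y by rewrite norm2_gt0.
pose z (i : 'I_k.+1) : C := l.1 ^+ i * l.2 ^+ (k - i).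
pose ph i : C := Num.conj (z i) * ((cabs (z i))^-1)%:C%C.
pose s i : R := eps * w i / (norm2 y * norm2 x).
have s0 i : 0 <= s i by rewrite divr_ge0 ?mulr_ge0 ?norm2_ge0.
have zph i : z i * ph i = (cabs (z i))%:C%C.
  rewrite /ph mulrA mul_conj -rmorphM /=; congr (_%:C)%C.
  have [->|zn0] := eqVneq (cabs (z i)) 0; first by rewrite expr0n mul0r.
  by rewrite expr2 mulfK.
have ph1 i : cabs (ph i) <= 1.
  rewrite cabsM cabsC cabsR ?invr_ge0 ?cabs_ge0 //.
  have [->|zn0] := eqVneq (cabs (z i)) 0; first by rewrite mul0r.
  by rewrite divff.
exists (fun i => (ph i * (s i)%:C%C) *: (y *m adjmx x)) => [i|].
  rewrite (le_trans (specnorm_rank1 _ _ _)) // cabsM cabsR //.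
  have -> : eps * w i = s i * (norm2 y * norm2 x).
    by rewrite divfK // mulf_neq0 // gt_eqF.
  by rewrite ler_wpM2r ?mulr_ge0 ?norm2_ge0 // ler_piMl.
have W0 : 0 <= eps * (norm2 y * norm2 x * wsum w l).
  rewrite !mulr_ge0 ?norm2_ge0 //; apply: sumr_ge0 => i _.
  by rewrite !mulr_ge0 ?exprn_ge0 ?cabs_ge0.
rewrite -[RHS](cabsR W0); congr cabs.
rewrite bilin_evalmx /wsum 2!mulr_sumr rmorph_sum; apply: eq_bigr => i _.
rewrite -/(z i) -scalemxAr -scalemxAl mx_scaleE.
have -> : (adjmx y *m (y *m adjmx x) *m x) 0 0
    = (norm2 y ^+ 2)%:C%C * (norm2 x ^+ 2)%:C%C.
  rewrite mulmxA -mulmxA [adjmx y *m y]mx11_scalar mul_scalar_mx mx_scaleE.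
  by rewrite !dot_self.
rewrite [LHS]mulrA [z i * _]mulrA (zph i) -!rmorphM /=; congr (_%:C)%C.
rewrite cabsM !cabsX /s; field.
by rewrite !gt_eqF.
Qed.

Lemma right_eigenvector_ex B l : simple_eigenvalue B l ->
  exists x, right_eigenvector B l x.
Proof.
move=> [[_]]; rewrite evalmx_det -det_tr => /eqP/det0P[v v0 vP] _.
exists v^T; split; first by rewrite -trmx0 (inj_eq trmx_inj).
by apply: trmx_inj; rewrite trmx_mul trmxK vP trmx0.
Qed.

(** A bootstrap: smallness of |r| bounds the quadratic error by half of d (|r| + eps W), which gives
    |r| <= K1 eps; reinserted, this makes the error at most K2 d eps^2. Passing from |r| to the
    chordal distance costs at most |r|^2, hence K1^2 in the final constant. *)
Lemma perturbed_eigenvalue_bounds (w : 'I_k.+1 -> R) B l (x y : 'cV[C]_n) :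
  simple_eigenvalue B l -> right_eigenvector B l x -> left_eigenvector B l y ->
  (forall i, 0 <= w i) ->
  let d := cabs ((adjmx y *m dmx B l *m x) 0 0) in
  exists2 e0 : R, 0 < e0 & exists2 K : R, 0 <= K &
  forall eps dB, 0 < eps < e0 -> (forall i, specnorm (dB i) <= eps * w i) ->
    let b := cabs ((adjmx y *m evalmx (hmxpoly dB) l *m x) 0 0) in
    let chi := chordal l (perturbed_eigenvalue B l dB) in
    [/\ simple_eigenvalue (addcoef B dB) (perturbed_eigenvalue B l dB),
        chi <= b / d + K * eps ^+ 2 & b / d - K * eps ^+ 2 <= chi].
Proof.
move=> sl xE yE w0 d; have [[l0 _] _] := sl.
have [dn0 _] := adj_simple sl xE yE.
have d0 : 0 < d by rewrite cabs_gt0.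
have [K K0 fo] := first_order sl xE yE.
have [T [T0 TE]] : exists T, 0 <= T /\ T = norm2 y * norm2 x * wsum w l.
  exists (norm2 y * norm2 x * wsum w l); split=> //.
  rewrite !mulr_ge0 ?norm2_ge0 //; apply: sumr_ge0 => i _.
  by rewrite !mulr_ge0 ?exprn_ge0 ?cabs_ge0.
have [W [W1 wW]] : exists W : R, 1 <= W /\ forall i, w i <= W.
  exists (1 + \sum_i w i); split=> [|i]; first by rewrite lerDl sumr_ge0.
  rewrite (bigD1 i) //= addrCA lerDl addr_ge0 // sumr_ge0 // => j _; exact: w0.
(* With |r| <= 2 e1 and eps W <= e1 the sum |r| + eps W is at most 3 e1, so 6 K e1 <= d halves the
   linear term as required. *)
have [e1 [e1p e12 Ke1]] : exists e1 : R, [/\ 0 < e1, e1 <= 1 / 2 & 6 * K * e1 <= d].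
  have h : 0 < 2 + 6 * K / d by rewrite ltr_pwDl // divr_ge0 ?(ltW d0) // mulr_ge0.
  exists (2 + 6 * K / d)^-1; split; first by rewrite invr_gt0.
    rewrite div1r lef_pV2 ?posrE // lerDl divr_ge0 ?(ltW d0) // mulr_ge0 //.
  rewrite ler_pdivrMr // mulrDr mulrCA divff ?gt_eqF // mulr1 lerDr.
  by rewrite mulr_ge0 // ltW.
have e11 : e1 <= 1 by lra.
have e21 : 2 * e1 <= 1 by lra.
have [dd ddp pe] := perturbed_eigenvalueP sl e1p.
have W0 : 0 <= W by apply: le_trans W1.
have [K1 [K10 K1d]] : exists K1, 0 <= K1 /\ K1 * d = 2 * T + W * d.
  exists (2 * T / d + W); split; last by field; rewrite gt_eqF.
  by rewrite addr_ge0 // divr_ge0 ?(ltW d0) // mulr_ge0.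
have [K2 [K20 K2E]] : exists K2, 0 <= K2 /\ K2 * d = K * (K1 + W) ^+ 2.
  exists (K * (K1 + W) ^+ 2 / d); split; last by rewrite divfK // gt_eqF.
  by rewrite divr_ge0 ?(ltW d0) // mulr_ge0 // sqr_ge0.
exists (Num.min dd e1 / W).
  by rewrite divr_gt0 ?(lt_le_trans _ W1) // lt_min ddp.
exists (K2 + K1 ^+ 2); first by rewrite addr_ge0 // sqr_ge0.
move=> eps dB /andP[eps0 epsW] dBw b chi.
move: epsW; rewrite ltr_pdivlMr ?(lt_le_trans _ W1) // lt_min => /andP[epsd epse].
have dBW i : specnorm (dB i) <= eps * W.
  by rewrite (le_trans (dBw i)) // ler_wpM2l ?(ltW eps0).
have [sm chie] := pe dB (fun i => le_trans (dBW i) (ltW epsd)).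
have [mu [r [mu0 mE r2]]] := chordal_near l0 e12 chie.
suff [? ?] : chi <= b / d + (K2 + K1 ^+ 2) * eps ^+ 2 /\
  b / d - (K2 + K1 ^+ 2) * eps ^+ 2 <= chi by split.
have [chil chiu] := chordal_line_pt_bounds r l0 mu0.
rewrite -mE -/chi in chil chiu.
have detr : \det (evalmx (hmxpoly (addcoef B dB)) (line_pt l r)) = 0.
  have [[_]] := sm; rewrite evalmx_det mE evalmx_scale detZ => /eqP.
  by rewrite mulf_eq0 !expf_eq0 (negPf mu0) !andbF => /eqP.
have bT : b <= eps * T by rewrite TE; apply: bilin_evalmx_le.
have eW0 : 0 <= eps * W by rewrite mulr_ge0 // ltW.
have := fo dB r (eps * W); rewrite eW0.
rewrite (le_trans (ltW epse) e11) (le_trans r2 e21).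
move=> /(_ isT isT (fun i u v => le_trans (cabs_le_specnorm _ _ _) (dBW i)) detr).
set D0 := (_ *m dmx B l *m x) 0 0 in d d0 K1d K2E Ke1 *.
set F0 := (_ *m evalmx _ l *m x) 0 0 in b bT *.
have rd : cabs (r * D0) = cabs r * d by rewrite cabsM.
have up := cabsD (r * D0 + F0) (- F0); rewrite addrK rd cabsN -/b in up.
have lo := cabsD (r * D0 + F0) (- (r * D0)).
rewrite [r * D0 + F0]addrC addrK cabsN rd -/b [F0 + _]addrC in lo.
move: up lo; set E := cabs (r * D0 + F0); have r0 := cabs_ge0 r.
move: r0 r2 chil chiu; set rho := cabs r.
clearbody E rho b d chi => r0 r2 chil chiu up lo EK.
have rW3 : rho + eps * W <= 3 * e1 by lra.
have rW0 : 0 <= rho + eps * W by lra.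
have E2 : 2 * E <= d * (rho + eps * W).
  have h := ler_wpM2l (mulr_ge0 K0 rW0) rW3.
  have h' := ler_wpM2r rW0 Ke1.
  lra.
have rK1 : rho <= K1 * eps.
  rewrite -(ler_pM2r d0).
  have -> : K1 * eps * d = eps * (K1 * d) by ring.
  rewrite K1d; lra.
have EK2 : E <= K2 * d * eps ^+ 2.
  rewrite K2E; apply: le_trans EK _.
  have -> : K * (K1 + W) ^+ 2 * eps ^+ 2 = K * ((K1 + W) * eps) ^+ 2 by ring.
  rewrite ler_wpM2l // lerXn2r ?nnegrE //; last by lra.
  by rewrite mulr_ge0 ?addr_ge0 // ltW.
have rho_up : rho <= b / d + K2 * eps ^+ 2.
  rewrite -(ler_pM2r d0) mulrDl divfK ?gt_eqF //; lra.
have rho_lo : b / d - K2 * eps ^+ 2 <= rho.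
  rewrite -(ler_pM2r d0) mulrBl divfK ?gt_eqF //; lra.
have r2K : rho ^+ 2 <= K1 ^+ 2 * eps ^+ 2.
  by rewrite -exprMn lerXn2r ?nnegrE // mulr_ge0 // ltW.
have chir : rho * chi <= rho * rho by rewrite ler_wpM2l.
have e2 : 0 <= K1 ^+ 2 * eps ^+ 2 by rewrite mulr_ge0 ?sqr_ge0.
by split; lra.
Qed.

(** For small eps every admissible ratio is at most T / d + K eps, and the extremal perturbation
    gives at least T / d - K eps. The upper bound also supplies the boundedness that [sup] needs. *)
Lemma cvg_sup_ratio (w : 'I_k.+1 -> R) B l (x y : 'cV[C]_n) :
  simple_eigenvalue B l -> right_eigenvector B l x -> left_eigenvector B l y ->
  (forall i, 0 <= w i) ->
  sup_ratio w B l eps @[eps --> 0^'+]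
    --> norm2 y * norm2 x * wsum w l / cabs ((adjmx y *m dmx B l *m x) 0 0).
Proof.
move=> sl xE yE w0.
have [e0 e0p [K K0 bnd]] := perturbed_eigenvalue_bounds sl xE yE w0.
have [dn0 _] := adj_simple sl xE yE.
set d := cabs _ in bnd *; have d0 : 0 < d by rewrite cabs_gt0.
set T := _ * wsum w l.
have close eps : 0 < eps < e0 -> `|T / d - sup_ratio w B l eps| <= K * eps.
  move=> eps0; have ep : 0 < eps by case/andP: eps0.
  have upper r : [set r : R | exists dB (x dx : 'cV[C]_n),
    [/\ right_eigenvector B l x,
        right_eigenvector (addcoef B dB) (perturbed_eigenvalue B l dB) (x + dx),
        (forall i, specnorm (dB i) <= eps * w i)
      & r = chordal l (perturbed_eigenvalue B l dB) / eps]] r -> r <= T / d + K * eps.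
    move=> [dB [x' [dx [_ _ dBw ->]]]].
    have [_ h _] := bnd eps dB eps0 dBw.
    rewrite ler_pdivrMr //; apply: le_trans h _.
    have := bilin_evalmx_le l x y dBw; rewrite -/T => h.
    have : cabs ((adjmx y *m evalmx (hmxpoly dB) l *m x) 0 0) / d <= eps * T / d.
      by rewrite ler_wpM2r // invr_ge0 ltW.
    have -> : eps * T / d = T / d * eps by ring.
    lra.
  have [dB dBw bE] := extremal_perturbation l (ltW ep) w0 xE.1 yE.1.
  have [sm _ h] := bnd eps dB eps0 dBw.
  have [z zE] := right_eigenvector_ex sm.
  have mem : [set r : R | exists dB (x dx : 'cV[C]_n),
    [/\ right_eigenvector B l x,
        right_eigenvector (addcoef B dB) (perturbed_eigenvalue B l dB) (x + dx),
        (forall i, specnorm (dB i) <= eps * w i)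
      & r = chordal l (perturbed_eigenvalue B l dB) / eps]]
    (chordal l (perturbed_eigenvalue B l dB) / eps).
    (* [dx] is the difference between any eigenvector [z] of the perturbed polynomial and [x]. *)
    by exists dB, x, (z - x); split=> //; rewrite addrC subrK.
  have lower : T / d - K * eps <= chordal l (perturbed_eigenvalue B l dB) / eps.
    rewrite ler_pdivlMr //; apply: le_trans h; rewrite bE -/T.
    have -> : eps * T / d = T / d * eps by ring.
    lra.
  have s1 : sup_ratio w B l eps <= T / d + K * eps.
    by apply: ge_sup => //; eexists; apply: mem.
  have s2 : T / d - K * eps <= sup_ratio w B l eps.
    apply: le_trans lower _; apply: ub_le_sup mem.
    by exists (T / d + K * eps) => r; apply: upper.
  rewrite ler_norml; lra.
apply/cvgrPdist_le => e ep.
near=> eps.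
have epsp : 0 < eps by near: eps; exact: nbhs_right_gt.
have epse0 : eps < e0 by near: eps; exact: nbhs_right_lt.
have epse : eps < e / (K + 1).
  by near: eps; apply: nbhs_right_lt; rewrite divr_gt0 // ltr_wpDl.
apply: le_trans (close eps _) _; first by rewrite epsp.
move: epse; rewrite ltr_pdivlMr ?ltr_wpDl // => h; lra.
Unshelve. all: by end_near.
Qed.

Lemma kappa_thetaE (w : 'I_k.+1 -> R) B l (x y : 'cV[C]_n) :
  simple_eigenvalue B l -> right_eigenvector B l x -> left_eigenvector B l y ->
  (forall i, 0 <= w i) ->
  kappa_theta w B l
    = norm2 y * norm2 x * wsum w l / cabs ((adjmx y *m dmx B l *m x) 0 0).
Proof.
move=> sl xE yE w0; apply: cvg_lim; first exact: Rhausdorff.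
exact: cvg_sup_ratio.
Qed.

End KappaTheta.

(** * Comparison of the two condition numbers *)

(** Cauchy-Schwarz against the constant vector 1 gives the factor sqrt n; conversely (sum c_i)^2
    contains every c_i^2, and its mixed terms are nonnegative. *)
Lemma sqrt_sum_sqr_bounds (R : realType) n (c : 'I_n -> R) : (forall i, 0 <= c i) ->
  \sum_i c i <= Num.sqrt n%:R * Num.sqrt (\sum_i c i ^+ 2) /\
  Num.sqrt (\sum_i c i ^+ 2) <= \sum_i c i.
Proof.
move=> c0; split.
  have := cauchy_schwarz (fun=> 1) c.
  by under eq_bigr do rewrite mul1r; rewrite expr1n sumr_const card_ord.
have s0 : 0 <= \sum_i c i by exact: sumr_ge0.
rewrite -[leRHS](ger0_norm s0) -sqrtr_sqr ler_wsqrtr //.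
rewrite [leRHS]expr2 mulr_suml; apply: ler_sum => i _.
rewrite expr2 ler_wpM2l // (bigD1 i) //= lerDl.
by apply: sumr_ge0.
Qed.

Theorem corollary3p3 (R : realType) (n k : nat)
  (B : 'I_k.+1 -> 'M[R[i]]_n) (alpha0 beta0 : R[i])
  (w : 'I_k.+1 -> R) (x y : 'cV[R[i]]_n) :
  regular B ->
  (alpha0, beta0) != (0, 0) ->
  simple_eigenvalue B (alpha0, beta0) ->
  right_eigenvector B (alpha0, beta0) x ->
  left_eigenvector B (alpha0, beta0) y ->
  (forall i, 0 <= w i) ->
  \sum_(i < k.+1) cabs alpha0 ^+ i * cabs beta0 ^+ (k - i) * w i != 0 ->
  1 / Num.sqrt k.+1%:R
    <= kappa_h w B (alpha0, beta0) x y / kappa_theta w B (alpha0, beta0)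
    <= 1.
Proof.
move=> _ _ sl xE yE w0 S0.
rewrite (kappa_thetaE sl xE yE w0) /kappa_h -/(dmx B (alpha0, beta0)).
have [dn0 _] := adj_simple sl xE yE.
set d := cabs ((_ *m dmx _ _ *m x) 0 0); have d0 : 0 < d by rewrite cabs_gt0.
have nx : 0 < norm2 x by rewrite norm2_gt0; case: xE.
have ny : 0 < norm2 y by rewrite norm2_gt0; case: yE.
rewrite /wsum /=; pose c (i : 'I_k.+1) := cabs alpha0 ^+ i * cabs beta0 ^+ (k - i) * w i.
have c0 i : 0 <= c i by rewrite /c !mulr_ge0 ?exprn_ge0 ?cabs_ge0 ?w0.
have -> : \sum_(i < k.+1) cabs alpha0 ^+ (2 * i) * cabs beta0 ^+ (2 * (k - i)) * w i ^+ 2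
    = \sum_i c i ^+ 2.
  by apply: eq_bigr => i _; rewrite /c !exprMn -!exprM ![(2 * _)%N]mulnC.
have [lo up] := sqrt_sum_sqr_bounds c0.
rewrite -/(c _) in S0 *; set S := \sum_i c i in S0 lo up *.
have Sp : 0 < S by rewrite lt0r S0 sumr_ge0.
set q := Num.sqrt (\sum_i _) in lo up *.
(* The norms of x and y and the denominator d cancel, leaving the quotient of the l2 and l1 norms of
   the c_i. *)
have -> : q * (norm2 y * norm2 x / d) / (norm2 y * norm2 x * S / d) = q / S.
  by field; rewrite !gt_eqF.
have k0 : 0 < Num.sqrt k.+1%:R :> R by rewrite sqrtr_gt0 ltr0n.
apply/andP; split; last by rewrite ler_pdivrMr // mul1r.
by rewrite ler_pdivrMr // mulrAC ler_pdivlMr // mul1r mulrC.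
Qed.
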